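(* Let $f,g:\mathbb{R}^{d_x}\times\mathbb{R}^{d_y}\to\mathbb{R}$ satisfy the standing assumption (a)–(e) in the context, with constants $\mu,C_f,L_f,L_g,\rho_f,\rho_g,\overline\sigma,\ell,\kappa$, and let $\varphi(x)=\min_{y\in Y^*(x)}f(x,y)$. Let $\epsilon>0$, $x_0\in\mathbb{R}^{d_x}$, $y_0\in\mathbb{R}^{d_y}$. Define $\Delta=\varphi(x_0)-\inf_{x\in\mathbb{R}^{d_x}}\varphi(x)$ and $R=\mathrm{dist}^2(y_0,Y^*(x_0))$, and suppose both $\Delta$ and $R$ are bounded. Set the parameters of the algorithm F${}^2$BA (see context) as $$\eta\asymp\ell^{-1}\kappa^{-3},\quad \sigma\asymp\min\Big\{\frac R\kappa,\ \frac{\epsilon}{\ell\kappa^3},\ \frac{L_g}{L_f},\ \frac{\rho_g}{\rho_f},\ \overline\sigma\Big\},\quad \tau=\frac1{\sigma L_f+L_g},\quad K\asymp\frac{L_g}{\mu}\log\Big(\frac{L_g}{\mu\sigma}\Big).$$ Then (for suitable choices of the hidden constants) F${}^2$BA finds an $\epsilon$-first-order stationary point of $\varphi$, i.e. an iterate $x_t$ with $\|\nabla\varphi(x_t)\|\le\epsilon$, within $T=O(\ell\kappa^3\epsilon^{-2})$ iterations. The total number of first-order oracle calls (evaluations of gradients of $f$ and $g$) is bounded by $O\big(\ell\kappa^4\epsilon^{-2}\log(\rho_f\ell\kappa/\epsilon)\big)$.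
   Context: A function $h:\mathbb{R}^d\to\mathbb{R}$ is $\mu$-PL ($\mu>0$) if it has a non-empty set of minimizers and $\|\nabla h(x)\|^2\ge2\mu(h(x)-\min h)$ for all $x$. For $\sigma\ge0$ let $h_\sigma=\sigma f+g$, $Y^*_\sigma(x)=\arg\min_{y\in\mathbb{R}^{d_y}}h_\sigma(x,y)$, and $Y^*(x)=Y^*_0(x)=\arg\min_yg(x,y)$. $\mathrm{dist}(v,S)=\inf_{s\in S}\|v-s\|$. Standing assumption. There are $\overline\sigma>0$ and positive constants such that: (a) $h_\sigma(x,y)$ is $\mu$-PL in $y$ (for every $x$) for every $0\le\sigma\le\overline\sigma$; (b) $f$ is $C_f$-Lipschitz in $y$ and has $L_f$-Lipschitz gradients; (c) $g$ has $L_g$-Lipschitz gradients; (d) $\nabla^2_{xy}f$ and $\nabla^2_{yy}f$ exist and are $\rho_f$-Lipschitz; (e) $g$ is twice differentiable with $\rho_g$-Lipschitz Hessian. Put $\ell=\max\{C_f,L_f,L_g,\rho_g\}$ and $\kappa=\ell/\mu$. Under this assumption $\varphi$ is differentiable. Algorithm F${}^2$BA$(x_0,y_0,\eta,\tau,\sigma,T,K)$: set $z_0=y_0$. For $t=0,\dots,T-1$: set $y_t^0=y_t$, $z_t^0=z_t$; for $k=0,\dots,K-1$ set $$z_t^{k+1}=z_t^k-\tau\nabla_yg(x_t,z_t^k),\qquad y_t^{k+1}=y_t^k-\tau\big(\sigma\nabla_yf(x_t,y_t^k)+\nabla_yg(x_t,y_t^k)\big);$$ then set $\hat\nabla\varphi(x_t)=\nabla_xf(x_t,y_t^K)+\big(\nabla_xg(x_t,y_t^K)-\nabla_xg(x_t,z_t^K)\big)/\sigma$,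 $x_{t+1}=x_t-\eta\hat\nabla\varphi(x_t)$, and $y_{t+1}=y_t^K$, $z_{t+1}=z_t^K$. Asymptotic notation: $\asymp$ and $O(\cdot)$ hide numerical constants; $\Delta$ and $R$ are treated as bounded quantities and may enter the hidden constants. The bounds are understood in the usual regime of small $\epsilon$ and $\kappa\ge1$. *)

(* Defs.v *)
From mathcomp Require Import all_boot all_order all_algebra.
From mathcomp Require Import all_classical all_reals all_analysis.
Set Implicit Arguments.
Unset Strict Implicit.
Unset Printing Implicit Defensive.
Import Order.TTheory GRing.Theory Num.Theory.
Import numFieldNormedType.Exports.
Local Open Scope classical_set_scope.
Local Open Scope ring_scope.

(* Vectors of R^n are row vectors. The library norm on matrices is the
   max-norm, which is equivalent to the Euclidean one for differentiability
   but gives different constants; hence the Euclidean and spectral norms. *)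
Definition enorm (R : realType) (n : nat) (v : 'rV[R]_n) : R :=
  Num.sqrt (\sum_(i < n) v 0 i ^+ 2).

(* The set is bounded above and contains 0, so this is a genuine supremum. *)
Definition opnorm (R : realType) (m n : nat) (A : 'M[R]_(m, n)) : R :=
  sup [set enorm (v *m A) | v in [set v : 'rV[R]_m | enorm v <= 1]].

Definition dist (R : realType) (n : nat) (v : 'rV[R]_n) (S : set 'rV[R]_n) : R :=
  inf [set enorm (v - s) | s in S].

Definition grad (R : realType) (n : nat) (h : 'rV[R]_n -> R) (x : 'rV[R]_n) :
    'rV[R]_n :=
  \row_(i < n) 'D_(delta_mx 0 i) h x.

Definition argmin (R : realType) (T : Type) (h : T -> R) : set T :=
  [set x | forall y, h x <= h y].

(* mu-PL; as the set of minimizers is nonempty, inf (range h) is min h. *)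
Definition PL (R : realType) (n : nat) (mu : R) (h : 'rV[R]_n -> R) : Prop :=
  argmin h !=set0 /\
  forall x, 2 * mu * (h x - inf (range h)) <= enorm (grad h x) ^+ 2.

Definition lipschitz_grad (R : realType) (n : nat) (L : R)
    (h : 'rV[R]_n -> R) : Prop :=
  (forall x, differentiable h x) /\
  (forall x x', enorm (grad h x - grad h x') <= L * enorm (x - x')).

Definition stationary (R : realType) (n : nat) (eps : R)
    (h : 'rV[R]_n -> R) (x : 'rV[R]_n) : Prop :=
  differentiable h x /\ enorm (grad h x) <= eps.

Section Bilevel.
Context {R : realType} {dx dy : nat}.
Implicit Types (f g : 'rV[R]_dx -> 'rV[R]_dy -> R).

Definition joint f (w : 'rV[R]_(dx + dy)) : R := f (lsubmx w) (rsubmx w).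

Definition grad_x f (x : 'rV[R]_dx) (y : 'rV[R]_dy) : 'rV[R]_dx :=
  grad (fun u => f u y) x.

Definition grad_y f (x : 'rV[R]_dx) (y : 'rV[R]_dy) : 'rV[R]_dy :=
  grad (f x) y.

(* The Jacobian 'J F p acts on row vectors on the right, so the (i, j) entry of
   hess_xy is the derivative in x_i of the derivative of f in y_j. *)
Definition hess_xy f (x : 'rV[R]_dx) (y : 'rV[R]_dy) : 'M[R]_(dx, dy) :=
  'J (fun u => grad_y f u y) x.

Definition hess_yy f (x : 'rV[R]_dx) (y : 'rV[R]_dy) : 'M[R]_dy :=
  'J (fun v => grad_y f x v) y.

Definition lipschitz_map (m n : nat) (L : R)
    (A : 'rV[R]_dx -> 'rV[R]_dy -> 'M[R]_(m, n)) : Prop :=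
  forall x y x' y',
    opnorm (A x y - A x' y') <= L * enorm (row_mx (x - x') (y - y')).

Definition penalty (sigma : R) f g (x : 'rV[R]_dx) (y : 'rV[R]_dy) : R :=
  sigma * f x y + g x y.

Definition Ystar g (x : 'rV[R]_dx) : set 'rV[R]_dy := argmin (g x).

(* Under the assumptions below f x attains its minimum on Ystar g x. *)
Definition hyperobj f g (x : 'rV[R]_dx) : R := inf (f x @` Ystar g x).

Record standing_assumption f g (mu Cf Lf Lg rhof rhog sbar : R) : Prop :=
  StandingAssumption {
  sa_mu_gt0 : 0 < mu;
  sa_Cf_gt0 : 0 < Cf;
  sa_Lf_gt0 : 0 < Lf;
  sa_Lg_gt0 : 0 < Lg;
  sa_rhof_gt0 : 0 < rhof;
  sa_rhog_gt0 : 0 < rhog;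
  sa_sbar_gt0 : 0 < sbar;
  sa_PL : forall sigma, 0 <= sigma <= sbar ->
    forall x, PL mu (penalty sigma f g x);
  sa_f_lip : forall x y y', `|f x y - f x y'| <= Cf * enorm (y - y');
  sa_f_grad : lipschitz_grad Lf (joint f);
  sa_g_grad : lipschitz_grad Lg (joint g);
  sa_f_diff_xy : forall x y, differentiable (fun u => grad_y f u y) x;
  sa_f_diff_yy : forall x y, differentiable (fun v => grad_y f x v) y;
  sa_f_hess_xy : lipschitz_map rhof (hess_xy f);
  sa_f_hess_yy : lipschitz_map rhof (hess_yy f);
  sa_g_diff2 : forall w, differentiable (grad (joint g)) w;
  sa_g_hess : forall w w',
    opnorm ('J (grad (joint g)) w - 'J (grad (joint g)) w')
      <= rhog * enorm (w - w') }.

Definition inner_z g (tau : R) (K : nat) (x : 'rV[R]_dx) (z : 'rV[R]_dy) :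
    'rV[R]_dy :=
  iter K (fun z' => z' - tau *: grad_y g x z') z.

Definition inner_y f g (tau sigma : R) (K : nat) (x : 'rV[R]_dx)
    (y : 'rV[R]_dy) : 'rV[R]_dy :=
  iter K (fun y' => y' - tau *: (sigma *: grad_y f x y' + grad_y g x y')) y.

Definition hypergrad_est f g (sigma : R) (x : 'rV[R]_dx) (y z : 'rV[R]_dy) :
    'rV[R]_dx :=
  grad_x f x y + sigma^-1 *: (grad_x g x y - grad_x g x z).

(* The triple after t outer iterations is (x_t, y_t, z_t). *)
Fixpoint F2BA f g (eta tau sigma : R) (K : nat)
    (x0 : 'rV[R]_dx) (y0 : 'rV[R]_dy) (t : nat) :
    'rV[R]_dx * 'rV[R]_dy * 'rV[R]_dy :=
  if t is t'.+1 then
    let: (x, y, z) := F2BA f g eta tau sigma K x0 y0 t' in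
    let yK := inner_y f g tau sigma K x y in
    let zK := inner_z g tau K x z in
    (x - eta *: hypergrad_est f g sigma x yK zK, yK, zK)
  else (x0, y0, y0).

Definition F2BA_x f g (eta tau sigma : R) (K : nat)
    (x0 : 'rV[R]_dx) (y0 : 'rV[R]_dy) (t : nat) : 'rV[R]_dx :=
  (F2BA f g eta tau sigma K x0 y0 t).1.1.

End Bilevel.

(* Each inner step evaluates one gradient of f and two of g (at y and at z);
   so does each hypergradient estimate. *)
Definition F2BA_oracle_calls (T K : nat) : nat := (T * (K * 3 + 3))%N.

(* Main.v *)
(* With admissible sigma, the estimator evaluated at exact minimizers y of
   sigma f + g and z of g differs from grad phi by O(ell kappa^3 sigma), and phi
   has a quadratic approximation with constant O(ell kappa^3).  Both come from one
   expansion, which needs no inverse of the possibly singular Hessian of g: the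
   minimizers move Lipschitz-continuously in x and sigma by the PL inequality, and
   the symmetry of the Hessian along these displacements replaces the inversion.
   The convergence proof is a descent argument on phi + lambda E, where E is the
   sum of the two optimality gaps in y and z.  Since the inner loops contract by
   a factor at most sigma^5, lambda can be chosen so that E absorbs the error of
   the estimator and lambda E is negligible at the start. *)

From HB Require Import structures.
Require Import Defs.
From mathcomp Require Import all_boot all_order all_algebra.
From mathcomp Require Import all_classical all_reals all_analysis.
From mathcomp Require Import ring lra.
Set Implicit Arguments.
Unset Strict Implicit.
Unset Printing Implicit Defensive.
Import Order.TTheory GRing.Theory Num.Theory.
Import numFieldNormedType.Exports.
Local Open Scope classical_set_scope.
Local Open Scope ring_scope.

(** Minimizers in [y] need not be unique and are not selected smoothly in [x], so there is no
    solution map to differentiate. Each statement about them therefore reads: a given minimizer of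
    one problem has a close minimizer of the other. Closeness always comes from one error bound: the
    distance to the minimizers is at most [2 / mu] times the gradient norm. Two facts make the
    choice immaterial: the PL inequality for small positive sigma forces [f x] to be constant on
    [Ystar g x], and the [x]-gradient of a function that is PL in [y] is the same at all its
    minimizers in [y]. The gradient of [hyperobj] is not given by a formula; it arises as the limit
    of the estimators for sigma tending to 0. Since the estimator divides by sigma, the gaps enter
    its squared error with a factor [s ^- 2]; as the inner loop count is logarithmic in [1 / s], a
    fixed power of [s] is gained at the price of a constant factor in [K]. *)

Section Euclidean.
Context {R : realType}.
Implicit Types n : nat.

(** * Euclidean inner product and norms *)

Definition dot n (u v : 'rV[R]_n) : R := \sum_(i < n) u 0 i * v 0 i.

Lemma dotC n (u v : 'rV[R]_n) : dot u v = dot v u.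
Proof. by apply: eq_bigr => i _; rewrite mulrC. Qed.

Lemma dotDl n (u v w : 'rV[R]_n) : dot (u + v) w = dot u w + dot v w.
Proof. by rewrite -big_split; apply: eq_bigr => i _; rewrite mxE mulrDl. Qed.

Lemma dotZl n a (u w : 'rV[R]_n) : dot (a *: u) w = a * dot u w.
Proof. by rewrite mulr_sumr; apply: eq_bigr => i _; rewrite mxE mulrA. Qed.

Lemma dotNl n (u w : 'rV[R]_n) : dot (- u) w = - dot u w.
Proof. by rewrite -scaleN1r dotZl mulN1r. Qed.

Lemma dotBl n (u v w : 'rV[R]_n) : dot (u - v) w = dot u w - dot v w.
Proof. by rewrite dotDl dotNl. Qed.

Lemma dotDr n (u v w : 'rV[R]_n) : dot w (u + v) = dot w u + dot w v.
Proof. by rewrite dotC dotDl !(dotC w). Qed.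

Lemma dotZr n a (u w : 'rV[R]_n) : dot w (a *: u) = a * dot w u.
Proof. by rewrite dotC dotZl dotC. Qed.

Lemma dotNr n (u w : 'rV[R]_n) : dot w (- u) = - dot w u.
Proof. by rewrite dotC dotNl dotC. Qed.

Lemma dotBr n (u v w : 'rV[R]_n) : dot w (u - v) = dot w u - dot w v.
Proof. by rewrite dotDr dotNr. Qed.

Lemma dot0l n (u : 'rV[R]_n) : dot 0 u = 0.
Proof. by rewrite -(scale0r 0) dotZl mul0r. Qed.

Lemma dot0r n (u : 'rV[R]_n) : dot u 0 = 0.
Proof. by rewrite dotC dot0l. Qed.

Lemma dot_ge0 n (u : 'rV[R]_n) : 0 <= dot u u.
Proof. by apply: sumr_ge0 => i _; rewrite -expr2 sqr_ge0. Qed.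

Lemma enorm_ge0 n (u : 'rV[R]_n) : 0 <= enorm u.
Proof. exact: sqrtr_ge0. Qed.

Lemma enorm_sqr n (u : 'rV[R]_n) : enorm u ^+ 2 = dot u u.
Proof.
rewrite /enorm sqr_sqrtr; first by apply: eq_bigr => i _; rewrite expr2.
by apply: sumr_ge0 => i _; rewrite sqr_ge0.
Qed.

Lemma enormZ n a (u : 'rV[R]_n) : enorm (a *: u) = `|a| * enorm u.
Proof.
apply/eqP; rewrite -(@eqrXn2 _ 2) ?enorm_ge0 ?mulr_ge0 ?enorm_ge0//.
by rewrite exprMn !enorm_sqr dotZl dotZr real_normK ?num_real// expr2 mulrA.
Qed.

Lemma enormN n (u : 'rV[R]_n) : enorm (- u) = enorm u.
Proof. by rewrite -scaleN1r enormZ normrN1 mul1r. Qed.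

Lemma enormC n (u v : 'rV[R]_n) : enorm (u - v) = enorm (v - u).
Proof. by rewrite -enormN opprB. Qed.

Lemma enorm0 n : enorm (0 : 'rV[R]_n) = 0.
Proof. by rewrite -(scale0r 0) enormZ normr0 mul0r. Qed.

Lemma enorm0_eq0 n (u : 'rV[R]_n) : enorm u = 0 -> u = 0.
Proof.
move=> u0; have := enorm_sqr u; rewrite u0 expr0n/= => /esym/eqP.
rewrite psumr_eq0 => [/allP h|i _]; last by rewrite -expr2 sqr_ge0.
apply/rowP => i; rewrite mxE.
by have := h i (mem_index_enum i); rewrite mulf_eq0 orbb => /eqP.
Qed.

Lemma dot_le n (u v : 'rV[R]_n) : `|dot u v| <= enorm u * enorm v.
Proof.
rewrite -(@ler_pXn2r _ 2) ?nnegrE ?mulr_ge0 ?enorm_ge0//.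
rewrite exprMn !enorm_sqr real_normK ?num_real//.
have [v0|v_neq0] := eqVneq (dot v v) 0.
  have -> : v = 0 by apply/enorm0_eq0/eqP; rewrite -sqrf_eq0 enorm_sqr v0.
  by rewrite !dot0r expr0n/= mulr0.
have v_gt0 : 0 < dot v v by rewrite lt_neqAle eq_sym v_neq0 dot_ge0.
have := dot_ge0 (dot v v *: u - dot u v *: v).
rewrite !(dotBl, dotBr, dotZl, dotZr) (dotC v u) => h.
by rewrite -(ler_pM2l v_gt0); lra.
Qed.

Lemma ler_dot n (u v : 'rV[R]_n) : dot u v <= enorm u * enorm v.
Proof. exact: le_trans (ler_norm _) (dot_le u v). Qed.

Lemma ler_enormD n (u v : 'rV[R]_n) : enorm (u + v) <= enorm u + enorm v.
Proof.
rewrite -(@ler_pXn2r _ 2) ?nnegrE ?addr_ge0 ?enorm_ge0//.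
rewrite sqrrD !enorm_sqr !(dotDl, dotDr) (dotC v u).
by have := ler_dot u v; lra.
Qed.

Lemma ler_enormB n (u v : 'rV[R]_n) : enorm (u - v) <= enorm u + enorm v.
Proof. by rewrite (le_trans (ler_enormD _ _))// enormN. Qed.

Lemma ler_enorm_trans n (w u v : 'rV[R]_n) :
  enorm (u - v) <= enorm (u - w) + enorm (w - v).
Proof. by rewrite (le_trans _ (ler_enormD _ _))// addrA subrK. Qed.

Lemma enorm_le_dot n (u : 'rV[R]_n) c :
  0 <= c -> (forall v, dot u v <= c * enorm v) -> enorm u <= c.
Proof.
move=> c0 /(_ u); rewrite -enorm_sqr expr2.
have [->|u0] := eqVneq (enorm u) 0 => //.
by rewrite ler_pM2r// lt_neqAle eq_sym u0 enorm_ge0.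
Qed.

Lemma enorm_coord n (u : 'rV[R]_n) i : `|u 0 i| <= enorm u.
Proof.
rewrite -sqrtr_sqr ler_wsqrtr// (bigD1 i)//= lerDl.
by apply: sumr_ge0 => j _; rewrite sqr_ge0.
Qed.

Lemma normr_le_enorm n (u : 'rV[R]_n) : `|u| <= enorm u.
Proof.
rewrite /Num.norm/= mx_normrE; apply: bigmax_le; first exact: enorm_ge0.
by case=> i j _ /=; rewrite (ord1 i) enorm_coord.
Qed.

Lemma coord_le_normr n (u : 'rV[R]_n) i : `|u 0 i| <= `|u|.
Proof.
by rewrite [leRHS]/Num.norm/= mx_normrE (le_bigmax _ (fun i => `|u i.1 i.2|) (0, i)).
Qed.

(** The factor [n] is crude but serves only limits, so no dimension reaches the final constants. *)
Lemma enorm_le_normr n (u : 'rV[R]_n) : enorm u <= n%:R * `|u|.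
Proof.
rewrite -(@ler_pXn2r _ 2) ?nnegrE ?mulr_ge0 ?enorm_ge0//.
rewrite enorm_sqr exprMn -natrX (@le_trans _ _ (\sum_(i < n) `|u| ^+ 2))//.
  apply: ler_sum => i _; rewrite -expr2 -real_normK ?num_real//.
  by rewrite ler_pXn2r ?nnegrE// coord_le_normr.
rewrite sumr_const card_ord -[leLHS]mulr_natl ler_wpM2r ?sqr_ge0// ler_nat.
by case: n {u} => // n; rewrite expnS expn1 leq_pmull.
Qed.

Lemma dot_delta n (u : 'rV[R]_n) i : dot u (delta_mx 0 i) = u 0 i.
Proof.
rewrite /dot (bigD1 i)//= mxE !eqxx mulr1 big1 ?addr0// => j ji.
by rewrite mxE (negPf ji) andbF mulr0.
Qed.

Lemma dot_row_mx m n (u u' : 'rV[R]_m) (v v' : 'rV[R]_n) :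
  dot (row_mx u v) (row_mx u' v') = dot u u' + dot v v'.
Proof.
rewrite /dot big_split_ord; congr (_ + _); apply: eq_bigr => i _;
  by rewrite ?row_mxEl ?row_mxEr.
Qed.

Lemma enorm_row_mx m n (u : 'rV[R]_m) (v : 'rV[R]_n) :
  enorm (row_mx u v) ^+ 2 = enorm u ^+ 2 + enorm v ^+ 2.
Proof. by rewrite !enorm_sqr dot_row_mx. Qed.

Lemma enorm_row_mx0 m n (u : 'rV[R]_m) : enorm (row_mx u (0 : 'rV[R]_n)) = enorm u.
Proof.
apply/eqP; rewrite -(@eqrXn2 _ 2) ?enorm_ge0//.
by rewrite enorm_row_mx enorm0 expr0n addr0.
Qed.

Lemma enorm_row_0mx m n (v : 'rV[R]_n) : enorm (row_mx (0 : 'rV[R]_m) v) = enorm v.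
Proof.
apply/eqP; rewrite -(@eqrXn2 _ 2) ?enorm_ge0//.
by rewrite enorm_row_mx enorm0 expr0n add0r.
Qed.

Lemma enorm_lsubmx m n (w : 'rV[R]_(m + n)) : enorm (lsubmx w) <= enorm w.
Proof.
rewrite -(@ler_pXn2r _ 2) ?nnegrE ?enorm_ge0//.
by rewrite -[w in leRHS]hsubmxK enorm_row_mx lerDl sqr_ge0.
Qed.

Lemma enorm_rsubmx m n (w : 'rV[R]_(m + n)) : enorm (rsubmx w) <= enorm w.
Proof.
rewrite -(@ler_pXn2r _ 2) ?nnegrE ?enorm_ge0//.
by rewrite -[w in leRHS]hsubmxK enorm_row_mx lerDr sqr_ge0.
Qed.

Lemma enorm_mulmx_le_opnorm m n (A : 'M[R]_(m, n)) (v : 'rV[R]_m) :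
  enorm (v *m A) <= opnorm A * enorm v.
Proof.
have coordE w j : (w *m A) 0 j = dot w (row j A^T).
  by rewrite mxE; apply: eq_bigr => i _; rewrite !mxE.
(* The Frobenius norm bounds the set; without an upper bound the supremum in [opnorm] would be a
   default value. *)
set B := Num.sqrt (\sum_(j < n) enorm (row j A^T) ^+ 2).
have ubB : ubound [set enorm (w *m A) | w in [set w : 'rV[R]_m | enorm w <= 1]] B.
  move=> _ [w /= w1 <-]; rewrite ler_sqrt; last first.
    by apply: sumr_ge0 => j _; rewrite sqr_ge0.
  apply: ler_sum => j _; rewrite coordE -real_normK ?num_real//.
  rewrite ler_pXn2r ?nnegrE ?enorm_ge0// (le_trans (dot_le _ _))//.
  by rewrite ler_piMl ?enorm_ge0.
have ub w : enorm w <= 1 -> enorm (w *m A) <= opnorm A.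
  by move=> w1; apply: ub_le_sup; [exists B|exists w].
have [v0|v0] := eqVneq (enorm v) 0.
  by rewrite v0 mulr0 (enorm0_eq0 v0) mul0mx enorm0.
have v_gt0 : 0 < enorm v by rewrite lt_neqAle eq_sym v0 enorm_ge0.
have := ub ((enorm v)^-1 *: v).
rewrite -scalemxAl !enormZ ger0_norm ?invr_ge0 ?enorm_ge0// mulVf// => /(_ (lexx _)).
by rewrite mulrC ler_pdivrMr.
Qed.

End Euclidean.

(** * Calculus along lines: Taylor estimates and symmetry of the Hessian *)

Section Lines.
Context {R : realType}.

Lemma is_derive_line n (W : normedModType R) (F : 'rV[R]_n -> W) (x u : 'rV[R]_n) (t : R) :
  differentiable F (x + t *: u) ->
  is_derive t 1 (fun s : R => F (x + s *: u)) ('D_u F (x + t *: u)).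
Proof.
move=> dF; have dq : derivable F (x + t *: u) u by exact: diff_derivable.
have E : (fun h : R => h^-1 *: (((fun s : R => F (x + s *: u)) \o shift t) (h *: 1)
    - F (x + t *: u))) =
  (fun h : R => h^-1 *: ((F \o shift (x + t *: u)) (h *: u) - F (x + t *: u))).
  apply/funext => h /=; congr (_ *: (F _ - _)).
  by rewrite [h *: 1]mulr1 scalerDl addrCA.
by split; rewrite /derivable /derive E.
Qed.

Lemma derive_grad n (h : 'rV[R]_n -> R) (x u : 'rV[R]_n) :
  differentiable h x -> 'D_u h x = dot (grad h x) u.
Proof.
move=> dh; rewrite deriveE// {1}(row_sum_delta u) linear_sum.
apply: eq_bigr => i _; rewrite linearZ /grad [in RHS]mxE deriveE//.
by rewrite mulrC.
Qed.

Lemma is_derive_line_grad n (h : 'rV[R]_n -> R) (x u : 'rV[R]_n) (t : R) :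
  (forall p, differentiable h p) ->
  is_derive t 1 (fun s : R => h (x + s *: u)) (dot (grad h (x + t *: u)) u).
Proof. by move=> dh; rewrite -derive_grad//; exact: is_derive_line. Qed.

Lemma is_derive_dot n (G : R -> 'rV[R]_n) (w : 'rV[R]_n) (t : R) dG :
  is_derive t 1 G dG -> is_derive t 1 (fun s => dot (G s) w) (dot dG w).
Proof.
move=> [dd <-]; have dco := (derivable_mxP G t 1).1 dd.
rewrite (_ : (fun s => dot (G s) w) =
    \sum_(i < n) (fun s => w 0 i *: G s 0 i)); last first.
  by apply/funext => s; rewrite fct_sumE; apply: eq_bigr => i _; rewrite mulrC.

rewrite derive_mx// /dot.
rewrite (eq_bigr (fun i => w 0 i *: 'D_1 (fun s => G s 0 i) t)); last first.
  by move=> i _; rewrite mxE mulrC.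
apply: is_derive_sum => i.
by apply: is_deriveZ; split => //; exact: dco.
Qed.

Lemma MVT01 (q dq : R -> R) : (forall t : R, is_derive t 1 q (dq t)) ->
  exists2 c, 0 < c < 1 & q 1 - q 0 = dq c.
Proof.
move=> dqE; have qc : {within `[0 : R, 1], continuous q}.
  by apply: derivable_within_continuous => s _; exact: ex_derive.
have [c c01 ->] := MVT ltr01 (fun t _ => dqE t) qc.
by exists c => //; rewrite subr0 mulr1.
Qed.

(** The quadratic is subtracted before the mean value theorem is applied, which yields [L / 2]
    without integration. Applied to [h] directly, the theorem would give [L], and then a gradient
    step of length [L^-1] would guarantee no decrease. The sign [s] treats both one-sided bounds at
    once. *)
Lemma taylor1_grad n (h : 'rV[R]_n -> R) L (x u : 'rV[R]_n) :
  lipschitz_grad L h ->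
  `|h (x + u) - h x - dot (grad h x) u| <= L / 2 * enorm u ^+ 2.
Proof.
move=> [dh Lh].
have bnd (s : R) : `|s| = 1 -> s * (h (x + u) - h x - dot (grad h x) u)
    <= L / 2 * enorm u ^+ 2.
  move=> s1.
  pose q (t : R) := s * (h (x + t *: u) - t * dot (grad h x) u)
                    - L / 2 * enorm u ^+ 2 * t ^+ 2.
  pose dq (t : R) := s * (dot (grad h (x + t *: u)) u - dot (grad h x) u)
                    - L * enorm u ^+ 2 * t.
  have dqE (t : R) : is_derive t 1 q (dq t).
    have D := is_deriveB
      (is_deriveZ s (is_deriveB (is_derive_line_grad x u t dh)
        (is_deriveM (is_derive_id t 1) (is_derive_cst (dot (grad h x) u) t 1))))
      (is_deriveZ (L / 2 * enorm u ^+ 2) (is_deriveX 2 (is_derive_id t 1))).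
    apply: (@is_derive_eq _ _ _ q t 1 _ _ D).
    by rewrite /dq /GRing.scale /= /GRing.scale /=; field.
  have [c /andP[c0 c1] qE] := MVT01 dqE.
  have : dq c <= 0.
    rewrite /dq -dotBl subr_le0 (le_trans (ler_norm _))// normrM s1 mul1r.
    rewrite (le_trans (dot_le _ _))//.
    rewrite (le_trans (ler_wpM2r (enorm_ge0 _) (Lh _ _)))//.
    rewrite addrC addKr enormZ gtr0_norm//; rewrite le_eqVlt; apply/orP; left; apply/eqP; ring.
  rewrite -qE /q !scale0r !addr0 scale1r expr0n/= expr1n.
  by rewrite mulrBr; lra.
by rewrite ler_norml; apply/andP; split;
  [have := bnd (-1) (normrN1 _)|have := bnd 1 (normr1 _)]; lra.
Qed.

Lemma is_derive_line_jacobian m n (F : 'rV[R]_m -> 'rV[R]_n) (x u : 'rV[R]_m) w (t : R) :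
  (forall p, differentiable F p) ->
  is_derive t 1 (fun s : R => dot (F (x + s *: u)) w)
    (dot (u *m 'J F (x + t *: u)) w).
Proof.
by move=> dF; apply: is_derive_dot; rewrite -deriveEjacobian//; exact: is_derive_line.
Qed.

Lemma taylor1_jacobian m n (F : 'rV[R]_m -> 'rV[R]_n) (rho : R) (p u : 'rV[R]_m) :
  0 <= rho -> (forall w, differentiable F w) ->
  (forall w w', opnorm ('J F w - 'J F w') <= rho * enorm (w - w')) ->
  enorm (F (p + u) - F p - u *m 'J F p) <= rho * enorm u ^+ 2.
Proof.
move=> rho0 dF Lip; apply: enorm_le_dot => [|w].
  by rewrite mulr_ge0 ?sqr_ge0.
have [c /andP[c0 c1]] := MVT01 (fun t => is_derive_line_jacobian p u w t dF).
rewrite scale1r scale0r addr0 => E.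
have -> : dot (F (p + u) - F p - u *m 'J F p) w
    = dot (u *m ('J F (p + c *: u) - 'J F p)) w.
  by rewrite mulmxBr !dotBl E.
rewrite (le_trans (ler_dot _ _))// ler_wpM2r ?enorm_ge0//.
rewrite (le_trans (enorm_mulmx_le_opnorm _ _))// expr2 mulrA ler_wpM2r ?enorm_ge0//.
rewrite (le_trans (Lip _ _))// ler_wpM2l// addrC addKr enormZ gtr0_norm//.
by rewrite ler_piMl ?enorm_ge0// ltW.
Qed.

(* Both [dot (u *m J) v] and [dot (v *m J) u] are the leading coefficient of the
   mixed second difference of h, which is symmetric in u and v. *)
Lemma jacobian_grad_sym n (h : 'rV[R]_n -> R) (rho : R) (p u v : 'rV[R]_n) :
  0 <= rho -> (forall w, differentiable h w) ->
  (forall w, differentiable (grad h) w) ->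
  (forall w w', opnorm ('J (grad h) w - 'J (grad h) w') <= rho * enorm (w - w')) ->
  dot (u *m 'J (grad h) p) v = dot (v *m 'J (grad h) p) u.
Proof.
move=> rho0 dh dF Lip.
set J := 'J (grad h) p.
pose S (a b : 'rV[R]_n) (t : R) :=
  h (p + t *: a + t *: b) - h (p + t *: a) - (h (p + t *: b) - h p).
have main a b (t : R) : 0 < t ->
    `|S a b t - t ^+ 2 * dot (b *m J) a|
      <= t ^+ 3 * (rho * ((enorm a + enorm b) ^+ 2 + enorm a ^+ 2) * enorm a).
  move=> t0; pose q (s : R) := h (p + t *: b + s *: (t *: a)) - h (p + s *: (t *: a)).
  have dq (s : R) : is_derive s 1 q
      (dot (grad h (p + t *: b + s *: (t *: a)) - grad h (p + s *: (t *: a))) (t *: a)).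
    have l1 := is_derive_line_grad (p + t *: b) (t *: a) s dh.
    have l2 := is_derive_line_grad p (t *: a) s dh.
    by rewrite dotBl; exact: is_deriveB.
  have [c /andP[c0 c1]] := MVT01 dq.
  have -> : q 1 - q 0 = S a b t.
    by rewrite /q /S !scale1r !scale0r !addr0 (addrAC p).
  move=> ->.
  (* Both gradients are expanded at the same point [p], so their difference is [(t *: b) *m J] up to
     an error of order [t ^+ 2]. *)
  have T1 := taylor1_jacobian p (t *: b + c *: (t *: a)) rho0 dF Lip.
  have T2 := taylor1_jacobian p (c *: (t *: a)) rho0 dF Lip.
  set X1 := grad h (p + (t *: b + _)) - _ - _ in T1.
  set X2 := grad h (p + c *: (t *: a)) - _ - _ in T2.
  have -> : dot (grad h (p + t *: b + c *: (t *: a)) - grad h (p + c *: (t *: a)))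
      (t *: a) - t ^+ 2 * dot (b *m J) a = t * dot (X1 - X2) a.
    rewrite /X1 /X2 /J mulmxDl -!addrA -(scalemxAl t b) dotZr.
    rewrite !(dotDl, dotNl, dotZl) (addrA p); ring.
  rewrite normrM gtr0_norm// exprS -mulrA ler_wpM2l ?(ltW t0)//.
  rewrite (le_trans (dot_le _ _))// mulrA ler_wpM2r ?enorm_ge0//.
  rewrite (le_trans (ler_enormB _ _))// (le_trans (lerD T1 T2))//.
  rewrite -mulrDr mulrCA ler_wpM2l// mulrDr -!exprMn.
  have bE x y : 0 <= x -> x <= y -> x ^+ 2 <= y ^+ 2 :> R.
    by move=> x0 xy; rewrite ler_pXn2r ?nnegrE// (le_trans x0).
  have ca : enorm (c *: (t *: a)) <= t * enorm a.
    rewrite !enormZ !gtr0_norm// ler_piMl ?mulr_ge0 ?enorm_ge0 ?ltW//.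
  apply: lerD; apply: bE; rewrite ?enorm_ge0//.
  rewrite (le_trans (ler_enormD _ _))// enormZ (gtr0_norm t0).
  by rewrite mulrDr addrC lerD.
have SC a b t : S a b t = S b a t.
  by rewrite /S (addrAC p); ring.
set d := dot (u *m J) v - dot (v *m J) u.
suff : `|d| = 0 by move/eqP; rewrite normr_eq0 subr_eq0 => /eqP.
apply/eqP; rewrite eq_le normr_ge0 andbT; apply/ler_addgt0Pl => e e0.
rewrite addr0.
set C1 := rho * ((enorm u + enorm v) ^+ 2 + enorm u ^+ 2) * enorm u.
set C2 := rho * ((enorm v + enorm u) ^+ 2 + enorm v ^+ 2) * enorm v.
have C1_ge0 : 0 <= C1 by rewrite !mulr_ge0 ?addr_ge0 ?sqr_ge0 ?enorm_ge0.
have C2_ge0 : 0 <= C2 by rewrite !mulr_ge0 ?addr_ge0 ?sqr_ge0 ?enorm_ge0.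
pose t := e / (C1 + C2 + 1).
have C_gt0 : 0 < C1 + C2 + 1 by lra.
have t0 : 0 < t by rewrite divr_gt0.
have := main u v t t0; have := main v u t t0; rewrite (SC v u) -/C1 -/C2 => h1 h2.
have t2 : 0 < t ^+ 2 by rewrite exprn_gt0.
have : `|t ^+ 2 * d| <= t ^+ 3 * (C1 + C2).
  move: h1 h2; rewrite /d !ler_norml => /andP[a1 a2] /andP[b1 b2].
  by apply/andP; split; lra.
rewrite normrM gtr0_norm// (exprSr t 2) -mulrA ler_pM2l// => dle; apply: (le_trans dle).
rewrite /t mulrAC ler_pdivrMr// ler_pM2l//; lra.
Qed.

End Lines.

(** * Sequences of finite length *)

Section SummableSteps.
Context {R : realType}.

(** [S] decreases to its infimum, so the steps beyond a late index have total length below any given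
    [e], and the sequence is Cauchy. *)
Lemma cvg_dominated_steps n (u : nat -> 'rV[R]_n) (S : nat -> R) :
  (forall k, 0 <= S k) ->
  (forall k, enorm (u k - u k.+1) <= S k - S k.+1) ->
  exists2 l : 'rV[R]_n, u k @[k --> \oo] --> l & enorm (u 0%N - l) <= S 0%N.
Proof.
move=> S0 uS.
have dist_le k j : enorm (u k - u (k + j)%N) <= S k - S (k + j)%N.
  elim: j => [|j IH]; first by rewrite addn0 !subrr enorm0.
  rewrite (le_trans (ler_enorm_trans (u (k + j)%N) _ _))// addnS.
  by rewrite (le_trans (lerD IH (uS _)))//; lra.
have Slb : has_inf (range S).
  by split; [exists (S 0%N), 0%N|exists 0 => _ [k _ <-]].
have /cauchy_cvg/cvg_ex[l ul] : cauchy (u k @[k --> \oo]).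
  apply/cauchyP => e e0.
  have [_ [k _ <-] Sk] := inf_adherent e0 Slb.
  exists (u k); exists k => // m /= km.
  rewrite -ball_normE /= (le_lt_trans (normr_le_enorm _))// -(subnKC km).
  rewrite (le_lt_trans (dist_le _ _))//.
  have : inf (range S) <= S (k + (m - k))%N.
    by apply: ge_inf; [case: Slb|exists (k + (m - k))%N].
  by lra.
exists l => //; apply/ler_addgt0Pr => e e0.
have [N _ /(_ _ (leqnn N)) uN] : \forall k \near \oo, `|l - u k| < e / (n%:R + 1).
  by move/cvgrPdist_lt: ul; apply; rewrite divr_gt0// ltr_wpDl.
rewrite (le_trans (ler_enorm_trans (u N) _ _))// lerD//.
  by have := dist_le 0%N N; rewrite add0n; have := S0 N; lra.
rewrite enormC (le_trans (enorm_le_normr _))//.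
move: uN; rewrite ltr_pdivlMr; last by rewrite ltr_wpDl.
have := normr_ge0 (l - u N); have : 0 <= n%:R :> R by [].
by nra.
Unshelve. all: by end_near. Qed.

End SummableSteps.

(** * Smooth PL functions: gradient descent, growth and error bounds *)

Section PolyakLojasiewicz.
Context {R : realType} {n : nat}.
Variables (h : 'rV[R]_n -> R) (L mu : R).
Hypotheses (L_gt0 : 0 < L) (mu_gt0 : 0 < mu).
Hypotheses (hL : lipschitz_grad L h) (hPL : PL mu h).

Let m := inf (range h).

Lemma inf_argmin y : argmin h y -> inf (range h) = h y.
Proof.
move=> hy; apply/eqP; rewrite eq_le; apply/andP; split.
  by apply: ge_inf; [exists (h y) => _ [z _ <-]; exact: hy|exists y].
by apply: lb_le_inf; [exists (h y), y|move=> _ [z _ <-]; exact: hy].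
Qed.

Lemma inf_range_le x : inf (range h) <= h x.
Proof. by have [[y hy] _] := hPL; rewrite (inf_argmin hy). Qed.

Lemma argminP x : h x <= m -> argmin h x.
Proof. by move=> hx y; apply: le_trans hx (inf_range_le y). Qed.

Lemma gradient_step_decrease t x : 0 <= t <= L^-1 ->
  h (x - t *: grad h x) <= h x - t / 2 * enorm (grad h x) ^+ 2.
Proof.
move=> /andP[t0 tL].
have := taylor1_grad x (- (t *: grad h x)) hL; rewrite ler_norml => /andP[_].
rewrite enormN enormZ ger0_norm// exprMn dotNr dotZr -enorm_sqr.
have := sqr_ge0 (enorm (grad h x)); set G := _ ^+ 2 => G0.
have : L * t <= 1 by rewrite -(mulfV (lt0r_neq0 L_gt0)) ler_wpM2l// ltW.
move=> Lt; have : L * t * (t * G) <= t * G by rewrite ler_piMl// mulr_ge0.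
by lra.
Qed.

Lemma enorm_grad_sqr_le x : enorm (grad h x) ^+ 2 <= 2 * L * (h x - m).
Proof.
have Li : 0 <= L^-1 <= L^-1 by rewrite lexx invr_ge0 ltW.
have := gradient_step_decrease x Li; have := inf_range_le (x - L^-1 *: grad h x).
rewrite -/m => a b; have : L^-1 / 2 * enorm (grad h x) ^+ 2 <= h x - m by lra.
by rewrite mulrAC ler_pdivrMr// ler_pdivrMl//; lra.
Qed.

Lemma grad_argmin y : argmin h y -> grad h y = 0.
Proof.
move=> hy; apply: enorm0_eq0; apply/eqP; rewrite -sqrf_eq0 eq_le sqr_ge0 andbT.
by have := enorm_grad_sqr_le y; rewrite /m (inf_argmin hy) subrr mulr0.
Qed.

Lemma gradient_step_contraction t x : 0 <= t <= L^-1 ->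
  h (x - t *: grad h x) - m <= (1 - t * mu) * (h x - m).
Proof.
move=> tL; have := gradient_step_decrease x tL; have /andP[t0 _] := tL.
have := hPL.2 x; rewrite -/m => /(ler_wpM2l t0); lra.
Qed.

(** The squared gradient lies between [2 * mu] and [2 * L] times the gap, which can be cancelled
    only if it is positive: a constant function is PL for every [mu]. *)
Lemma PL_le_smooth x : ~ argmin h x -> mu <= L.
Proof.
move=> hx; have gap : 0 < h x - m.
  by rewrite subr_gt0 ltNge; apply/negP => /argminP.
have := hPL.2 x; rewrite -/m => /le_trans/(_ (enorm_grad_sqr_le x)).
by rewrite ler_pM2r// ler_pM2l.
Qed.

Lemma gap_le_dist_argmin x y : argmin h y ->
  h x - m <= L / 2 * enorm (x - y) ^+ 2.
Proof.
move=> hy; have := taylor1_grad y (x - y) hL.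
rewrite [y + _]addrC subrK grad_argmin// dot0l subr0 /m (inf_argmin hy).
by apply: le_trans; exact: ler_norm.
Qed.

(* Along gradient descent the square root of the gap decreases at least
   proportionally to the step length, so the iterates converge. *)
Lemma argmin_near_gap x :
  exists2 y, argmin h y & enorm (x - y) ^+ 2 <= 8 / mu * (h x - m).
Proof.
have [hx|hx] := pselect (argmin h x).
  by exists x => //; rewrite subrr enorm0 expr0n /m (inf_argmin hx) subrr mulr0.
have muL : mu * L^-1 <= 1.
  by rewrite ler_pdivrMr// mul1r; exact: PL_le_smooth hx.
have Li : 0 <= L^-1 <= L^-1 by rewrite lexx invr_ge0 ltW.
pose u k := iter k (fun z => z - L^-1 *: grad h z) x.
pose d k := h (u k) - m.
have d_ge0 k : 0 <= d k by rewrite subr_ge0 inf_range_le.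
(* [c] is fixed by [4 * a <= c * G] below: as [b <= a], the product [(a - b) * (4 * a)] is at least
   [2 * (a ^+ 2 - b ^+ 2)], hence at least [L^-1 * G ^+ 2]. *)
pose c := Num.sqrt (8 / mu).
have c_ge0 : 0 <= c by exact: sqrtr_ge0.
have c2 : c ^+ 2 * mu = 8 by rewrite sqr_sqrtr ?divr_ge0 ?ltW// divfK// gt_eqF.
pose S k := c * Num.sqrt (d k).
have S_ge0 k : 0 <= S k by rewrite mulr_ge0// sqrtr_ge0.
have uS k : enorm (u k - u k.+1) <= S k - S k.+1.
  have -> : u k - u k.+1 = L^-1 *: grad h (u k) by rewrite /= opprB addrC subrK.
  rewrite enormZ gtr0_norm ?invr_gt0// -mulrBr.
  have dec := gradient_step_decrease (u k) Li; rewrite -/(u k.+1) in dec.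
  have pl := hPL.2 (u k); rewrite -/m -/(d k) in pl.
  set G := enorm (grad h (u k)) in dec pl *.
  have G0 : 0 <= G by exact: enorm_ge0.
  set a := Num.sqrt (d k); set b := Num.sqrt (d k.+1).
  have a0 : 0 <= a by exact: sqrtr_ge0.
  have b0 : 0 <= b by exact: sqrtr_ge0.
  have a2 : a ^+ 2 = d k by rewrite sqr_sqrtr.
  have b2 : b ^+ 2 = d k.+1 by rewrite sqr_sqrtr.
  have ab : b ^+ 2 <= a ^+ 2 - L^-1 / 2 * G ^+ 2.
    by rewrite a2 b2 /d; lra.
  have Lp : 0 < L^-1 by rewrite invr_gt0.
  have ba : b <= a.
    rewrite -(@ler_pXn2r _ 2) ?nnegrE// (le_trans ab)// gerBl.
    by rewrite mulr_ge0 ?sqr_ge0// divr_ge0// ltW.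
  have aG : 4 * a <= c * G.
    rewrite -(@ler_pXn2r _ 2) ?nnegrE ?mulr_ge0// !exprMn a2.
    have := ler_wpM2l (sqr_ge0 c) pl.
    suff -> : c ^+ 2 * (2 * mu * d k) = 16 * d k by lra.
    have -> : c ^+ 2 * (2 * mu * d k) = 2 * (c ^+ 2 * mu) * d k by ring.
    by rewrite c2; lra.
  have [->|Gn] := eqVneq G 0; first by rewrite mulr0 mulr_ge0// subr_ge0.
  have Gp : 0 < G by rewrite lt_neqAle eq_sym Gn.
  rewrite -(ler_pM2r Gp) -mulrA -expr2.
  have : (a - b) * (4 * a) <= (a - b) * (c * G) by rewrite ler_wpM2l// subr_ge0.
  by nra.
have [l ul xl] := cvg_dominated_steps S_ge0 uS.
exists l; last first.
  have -> : 8 / mu * (h x - m) = S 0%N ^+ 2.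
    by rewrite exprMn /c !sqr_sqrtr// divr_ge0// ltW.
  by rewrite ler_pXn2r ?nnegrE ?enorm_ge0.
apply: argminP.
have hul : h (u k) @[k --> \oo] --> h l.
  by apply: continuous_cvg => //; apply: differentiable_continuous; case: hL.
have dgeo k : d k <= geometric (d 0%N) (1 - mu * L^-1) k.
  elim: k => [|k IH]; first by rewrite /= expr0 mulr1.
  have := gradient_step_contraction (u k) Li; rewrite -/(u k.+1) -/(d k.+1) -/(d k).
  move=> /le_trans; apply; rewrite (mulrC L^-1) /= exprS mulrCA ler_wpM2l//.
  by rewrite subr_ge0.
have geo0 : geometric (d 0%N) (1 - mu * L^-1) k @[k --> \oo] --> 0.
  apply: cvg_geometric; have : 0 < mu * L^-1 by rewrite mulr_gt0// invr_gt0.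
  by rewrite ltr_norml => ?; apply/andP; split; lra.
have d0 : d k @[k --> \oo] --> h l - m by apply: cvgB => //; exact: cvg_cst.
rewrite -subr_le0; apply: (ler_cvg_to d0 geo0).
by near=> k; exact: dgeo.
Unshelve. all: by end_near. Qed.

(** The PL inequality turns the bound by the gap into one linear in the gradient. In this form
    perturbations are easy: a minimizer of one function has a small gradient for a nearby function,
    hence is close to one of its minimizers. *)
Lemma argmin_near_grad x :
  exists2 y, argmin h y & enorm (x - y) <= 2 / mu * enorm (grad h x).
Proof.
have [y hy xy] := argmin_near_gap x; exists y => //.
have rhs_ge0 : 0 <= 2 / mu * enorm (grad h x).
  by rewrite mulr_ge0 ?enorm_ge0// divr_ge0// ltW.
rewrite -(@ler_pXn2r _ 2) ?nnegrE ?enorm_ge0//.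
rewrite (le_trans xy)// exprMn.
have -> : 8 / mu * (h x - m) = (2 / mu) ^+ 2 * (2 * mu * (h x - m)).
  by field; rewrite gt_eqF.
by rewrite ler_wpM2l ?sqr_ge0//; have [_] := hPL; apply.
Qed.

End PolyakLojasiewicz.

(** * Differentiability from quadratic expansions *)

Section QuadraticApproximation.
Context {R : realType}.

Lemma differentiable_littleo (V W : normedModType R) (f : V -> W)
    (df : {linear V -> W}) x :
  continuous df -> f \o shift x = cst (f x) + df +o_ 0 id ->
  differentiable f x /\ 'd f x = df :> (V -> W).
Proof.
move=> dc E; have dE := diff_unique dc E.
by split=> //; apply/diff_locallyP; rewrite dE.
Qed.

(** Serves to differentiate functions that are known only through inequalities, such as partial maps
    and [hyperobj]. *)
Lemma differentiable_quadratic n (h : 'rV[R]_n -> R) (x G : 'rV[R]_n) c :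
  (forall x', `|h x' - h x - dot G (x' - x)| <= c * enorm (x' - x) ^+ 2) ->
  differentiable h x /\ grad h x = G.
Proof.
move=> hq.
have lin : linear (dot G : 'rV[R]_n -> R) by move=> a u v; rewrite dotDr dotZr.
pose linM := GRing.isLinear.Build _ _ _ _ _ lin.
pose dL : {linear 'rV[R]_n -> R} := HB.pack (dot G : 'rV[R]_n -> R) linM.
have dc : continuous dL.
  apply: bounded_linear_continuous; apply/linear_boundedP; near=> r => u.
  rewrite /= (le_trans (dot_le _ _))//.
  rewrite (le_trans (ler_wpM2l (enorm_ge0 _) (enorm_le_normr u)))// mulrA.
  rewrite ler_wpM2r//; near: r; apply: nbhs_pinfty_ge; exact: num_real.
have c1 : 0 < `|c| + 1 by rewrite ltr_wpDl.
have [dh dE] : differentiable h x /\ 'd h x = dL :> (_ -> _).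
  apply: differentiable_littleo => //; apply/eqaddoP => e e0.
  have small : \forall u \near (0 : 'rV[R]_n),
      `|u| <= e / ((`|c| + 1) * (n%:R + 1)) / (n%:R + 1).
    by apply: nbhs0_le; rewrite !divr_gt0 ?mulr_gt0// ltr_wpDl.
  near=> u.
  have : enorm u <= e / ((`|c| + 1) * (n%:R + 1)).
    rewrite (le_trans (enorm_le_normr u))//.
    have n1 : 0 < n%:R + 1 :> R by rewrite ltr_wpDl.
    rewrite (@le_trans _ _ ((n%:R + 1) * `|u|))//; first by rewrite ler_wpM2r// lerDl.
    rewrite mulrC -ler_pdivlMr//; near: u; exact: small.
  have n1 : 0 < n%:R + 1 :> R by rewrite ltr_wpDl.
  rewrite ler_pdivlMr ?mulr_gt0// => ue.
  have := hq (u + x); rewrite addrK.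
  have -> : (h \o shift x - (cst (h x) + dL)) u = h (u + x) - h x - dot G u.
    by rewrite -addrA -opprD.
  move=> /le_trans; apply; rewrite expr2 mulrA.
  have u0 := enorm_ge0 u.
  rewrite (@le_trans _ _ ((`|c| + 1) * enorm u * ((n%:R + 1) * `|u|)))//.
    apply: (@le_trans _ _ ((`|c| + 1) * enorm u * enorm u)).
      by rewrite !ler_wpM2r// (le_trans (ler_norm c))// lerDl.
    rewrite ler_wpM2l ?mulr_ge0 ?(ltW c1)//.
    by rewrite (le_trans (enorm_le_normr u))// ler_wpM2r// lerDl.
  rewrite [X in X <= _](_ : _ = enorm u * ((`|c| + 1) * (n%:R + 1)) * `|u|); last by ring.
  by rewrite ler_wpM2r.
split=> //; apply/rowP => i.
by rewrite mxE deriveE// dE /= dot_delta.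
Unshelve. all: by end_near. Qed.

(* Two slopes P s and P s' both approximate h to first order, hence differ by at
   most B (s + s'); their limit as s -> 0 is taken coordinatewise as a supremum. *)
Lemma differentiable_quadratic_family n (h : 'rV[R]_n -> R) (x : 'rV[R]_n)
    (s0 A B : R) (P : R -> 'rV[R]_n) : 0 < s0 -> 0 <= B ->
  (forall s, 0 < s <= s0 -> forall x',
    `|h x' - h x - dot (P s) (x' - x)|
      <= A * enorm (x' - x) ^+ 2 + B * s * enorm (x' - x)) ->
  [/\ differentiable h x,
      forall x', `|h x' - h x - dot (grad h x) (x' - x)| <= A * enorm (x' - x) ^+ 2
    & forall s, 0 < s <= s0 -> enorm (P s - grad h x) <= B * s].
Proof.
move=> s0_gt0 B0 hP.
have close s s' : 0 < s <= s0 -> 0 < s' <= s0 -> enorm (P s - P s') <= B * (s + s').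
  move=> Hs Hs'; have /andP[sp _] := Hs; have /andP[s'p _] := Hs'.
  apply: enorm_le_dot => [|v]; first by rewrite mulr_ge0// addr_ge0// ltW.
  apply/ler_addgt0Pr => e e0.
  have A1 : 0 < 2 * `|A| * enorm v ^+ 2 + 1.
    by rewrite ltr_wpDl// mulr_ge0 ?sqr_ge0// mulr_ge0.
  (* Evaluating both expansions at [x + t *: v] and dividing by [t] leaves a term
     [2 * A * t * |v|^2] besides the claimed bound; this [t] makes it at most [e]. *)
  pose t := e / (2 * `|A| * enorm v ^+ 2 + 1).
  have t0 : 0 < t by rewrite divr_gt0.
  have := hP _ Hs (x + t *: v); have := hP _ Hs' (x + t *: v).
  have -> : x + t *: v - x = t *: v by rewrite addrAC subrr add0r.
  rewrite !dotZr enormZ (gtr0_norm t0).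
  rewrite !ler_norml => /andP[a1 a2] /andP[b1 b2].
  rewrite -(ler_pM2l t0) dotBl mulrDr.
  have : t * e = t * (2 * `|A| * (t * enorm v ^+ 2)) + t * t.
    have et : e = t * (2 * `|A| * enorm v ^+ 2 + 1) by rewrite /t divfK// gt_eqF.
    by rewrite {1}et; ring.
  have : A * (t * enorm v) ^+ 2 <= t * (`|A| * (t * enorm v ^+ 2)).
    have -> : t * (`|A| * (t * enorm v ^+ 2)) = `|A| * (t * enorm v) ^+ 2 by ring.
    by rewrite ler_wpM2r ?sqr_ge0// ler_norm.
  have := mulr_gt0 t0 t0.
  have -> : B * (s + s') * enorm v = B * s * enorm v + B * s' * enorm v by ring.
  have := sqr_ge0 t; rewrite expr2 => tt.
  by lra.
pose E i := [set P s 0 i - B * s | s in [set s | 0 < s <= s0]].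
have EP i s' : 0 < s' <= s0 -> ubound (E i) (P s' 0 i + B * s').
  move=> Hs' _ [s /= Hs <-].
  have := close _ _ Hs Hs'; have := enorm_coord (P s - P s') i.
  by rewrite !mxE => /le_trans/[apply]; rewrite ler_norml => /andP[_]; lra.
have s0s0 : 0 < s0 <= s0 by rewrite s0_gt0 lexx.
pose G : 'rV[R]_n := \row_i sup (E i).
have Gi i s : 0 < s <= s0 -> `|P s 0 i - G 0 i| <= B * s.
  move=> Hs; rewrite mxE ler_distl; apply/andP; split; last first.
    have : P s 0 i - B * s <= sup (E i).
      by apply: ub_le_sup; [exists (P s0 0 i + B * s0); exact: EP|exists s].
    by lra.
  have : sup (E i) <= P s 0 i + B * s.
    by apply: ge_sup; [exists (P s 0 i - B * s), s|exact: EP].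
  by lra.
have PG s : 0 < s <= s0 -> enorm (P s - G) <= n%:R * (B * s).
  move=> Hs; rewrite (le_trans (enorm_le_normr _))// ler_wpM2l//.
  rewrite /Num.norm/= mx_normrE; apply: bigmax_le.
    by rewrite mulr_ge0// ltW//; case/andP: Hs.
  by case=> i j _ /=; rewrite (ord1 i) !mxE; have := Gi j s Hs; rewrite mxE.
have hG x' : `|h x' - h x - dot G (x' - x)| <= A * enorm (x' - x) ^+ 2.
  apply/ler_addgt0Pr => e e0.
  set D := enorm (x' - x); have D0 : 0 <= D := enorm_ge0 _.
  pose C := B * D * (n%:R + 1); have C0 : 0 <= C by rewrite !mulr_ge0// ltr_wpDl.
  pose s := Num.min s0 (e / (C + 1)).
  have C1 : 0 < C + 1 by lra.
  have sp : 0 < s by rewrite lt_min s0_gt0 divr_gt0.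
  have Hs : 0 < s <= s0 by rewrite sp ge_min lexx.
  have : s * (C + 1) <= e by rewrite -ler_pdivlMr// ge_min lexx orbT.
  have := hP _ Hs x'; rewrite -/D.
  have : `|dot (P s - G) (x' - x)| <= n%:R * (B * s) * D.
    by rewrite (le_trans (dot_le _ _))// ler_wpM2r// PG.
  rewrite dotBl !ler_norml => /andP[a1 a2] /andP[b1 b2] Cs.
  have CsE : s * C = n%:R * (B * s) * D + B * s * D by rewrite /C; ring.
  by apply/andP; split; lra.
have [dh gE] := differentiable_quadratic hG; rewrite gE; split=> // s Hs.
have /andP[sp _] := Hs.
apply/ler_addgt0Pr => e e0.
(* The coordinatewise bound [PG] costs a factor [n]. Passing through [P s'] with [s'] tending to 0
   removes it, since [close] is free of it. *)
pose C := B * (n%:R + 1); have C0 : 0 <= C by rewrite !mulr_ge0// ltr_wpDl.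
have C1 : 0 < C + 1 by lra.
pose s' := Num.min s0 (e / (C + 1)).
have s'p : 0 < s' by rewrite lt_min s0_gt0 divr_gt0.
have Hs' : 0 < s' <= s0 by rewrite s'p ge_min lexx.
have : s' * (C + 1) <= e by rewrite -ler_pdivlMr// ge_min lexx orbT.
have := close _ _ Hs Hs'; have := PG _ Hs'.
have := ler_enorm_trans (P s') (P s) G.
have CsE : s' * C = n%:R * (B * s') + B * s' by rewrite /C; ring.
by lra.
Qed.

End QuadraticApproximation.

(** * Partial gradients and smoothness of the penalty *)

Section PartialGradients.
Context {R : realType} {dx dy : nat}.
Implicit Types (f g : 'rV[R]_dx -> 'rV[R]_dy -> R).

Lemma joint_row_mx f x y : joint f (row_mx x y) = f x y.
Proof. by rewrite /joint row_mxKl row_mxKr. Qed.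

Lemma grad_joint f x y : (forall w, differentiable (joint f) w) ->
  grad (joint f) (row_mx x y) = row_mx (grad_x f x y) (grad_y f x y).
Proof.
move=> df; apply/rowP => k; rewrite mxE.
case: (split_ordP k) => i ->; rewrite ?row_mxEl ?row_mxEr /grad_x /grad_y mxE /derive.
  rewrite (_ : (fun t : R => _) = (fun t : R =>
    t^-1 *: (((fun u => f u y) \o shift x) (t *: delta_mx 0 i) - f x y)))//.
  apply/funext => t /=; rewrite joint_row_mx delta_mx_lshift.
  by rewrite scale_row_mx scaler0 add_row_mx add0r joint_row_mx.
rewrite (_ : (fun t : R => _) = (fun t : R =>
  t^-1 *: ((f x \o shift y) (t *: delta_mx 0 i) - f x y)))//.
apply/funext => t /=; rewrite joint_row_mx delta_mx_rshift.
by rewrite scale_row_mx scaler0 add_row_mx add0r joint_row_mx.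
Qed.

Section Smooth.
Variables (f : 'rV[R]_dx -> 'rV[R]_dy -> R) (L : R).
Hypothesis fL : lipschitz_grad L (joint f).

Let df := fL.1.

Lemma enorm_grad_x_sub x y x' y' :
  enorm (grad_x f x y - grad_x f x' y') <= L * enorm (row_mx (x - x') (y - y')).
Proof.
have := fL.2 (row_mx x y) (row_mx x' y').
rewrite !grad_joint// opp_row_mx add_row_mx opp_row_mx add_row_mx.
apply: le_trans; rewrite -[X in X <= _]/(enorm _).
by have := enorm_lsubmx (row_mx (grad_x f x y - grad_x f x' y')
  (grad_y f x y - grad_y f x' y')); rewrite row_mxKl.
Qed.

Lemma enorm_grad_y_sub x y x' y' :
  enorm (grad_y f x y - grad_y f x' y') <= L * enorm (row_mx (x - x') (y - y')).
Proof.
have := fL.2 (row_mx x y) (row_mx x' y').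
rewrite !grad_joint// opp_row_mx add_row_mx opp_row_mx add_row_mx.
apply: le_trans.
by have := enorm_rsubmx (row_mx (grad_x f x y - grad_x f x' y')
  (grad_y f x y - grad_y f x' y')); rewrite row_mxKr.
Qed.

Lemma enorm_grad_x_sub_r x y y' :
  enorm (grad_x f x y - grad_x f x y') <= L * enorm (y - y').
Proof. by have := enorm_grad_x_sub x y x y'; rewrite subrr enorm_row_0mx. Qed.

Lemma enorm_grad_y_sub_r x y y' :
  enorm (grad_y f x y - grad_y f x y') <= L * enorm (y - y').
Proof. by have := enorm_grad_y_sub x y x y'; rewrite subrr enorm_row_0mx. Qed.

Lemma enorm_grad_y_sub_l x x' y :
  enorm (grad_y f x y - grad_y f x' y) <= L * enorm (x - x').
Proof. by have := enorm_grad_y_sub x y x' y; rewrite subrr enorm_row_mx0. Qed.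

Lemma taylor1_joint x y x' y' :
  `|f x' y' - f x y - dot (grad_x f x y) (x' - x) - dot (grad_y f x y) (y' - y)|
    <= L / 2 * (enorm (x' - x) ^+ 2 + enorm (y' - y) ^+ 2).
Proof.
have := taylor1_grad (row_mx x y) (row_mx (x' - x) (y' - y)) fL.
rewrite add_row_mx ![_ + (_ - _)]addrC !subrK !joint_row_mx grad_joint// dot_row_mx.
by rewrite enorm_row_mx opprD addrA.
Qed.

Lemma lipschitz_grad_snd x : lipschitz_grad L (f x).
Proof.
split=> [y|y y']; last exact: enorm_grad_y_sub_r.
apply: (@differentiable_quadratic _ _ _ _ (grad_y f x y) (L / 2) _).1 => y'.
have := taylor1_joint x y x y'.
by rewrite !subrr dot0r subr0 enorm0 expr0n add0r.
Qed.

End Smooth.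

Lemma enorm_grad_le n (h : 'rV[R]_n -> R) C (x : 'rV[R]_n) : 0 <= C ->
  differentiable h x -> (forall x', `|h x' - h x| <= C * enorm (x' - x)) ->
  enorm (grad h x) <= C.
Proof.
move=> C0 dh hC; apply: enorm_le_dot => // v; rewrite -derive_grad//.
apply: limr_le; first exact: diff_derivable.
near=> t; have t0 : t != 0 by near: t; exact: nbhs_dnbhs_neq.
rewrite (le_trans (ler_norm _))// normrM normfV ler_pdivrMl ?normr_gt0//=.
rewrite (le_trans (hC _))// addrK enormZ; rewrite le_eqVlt; apply/orP; left.
by apply/eqP; ring.
Unshelve. all: by end_near. Qed.

Lemma grad_penalty_joint s f g w :
  (forall w, differentiable (joint f) w) -> (forall w, differentiable (joint g) w) ->
  grad (joint (penalty s f g)) w = s *: grad (joint f) w + grad (joint g) w.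
Proof.
move=> df dg; apply/rowP => i; rewrite !mxE.
have d1 : derivable (joint f) w (delta_mx 0 i) by exact: diff_derivable.
have d2 : derivable (joint g) w (delta_mx 0 i) by exact: diff_derivable.
by have := deriveD (derivableZ (k := s) d1) d2; rewrite (deriveZ s d1).
Qed.

Lemma lipschitz_grad_penalty s Lf Lg f g : 0 <= s ->
  lipschitz_grad Lf (joint f) -> lipschitz_grad Lg (joint g) ->
  lipschitz_grad (s * Lf + Lg) (joint (penalty s f g)).
Proof.
move=> s0 [df Lfs] [dg Lgs]; split=> [w|w w'].
  rewrite (_ : joint _ = s \*: joint f + joint g); last by apply/funext.
  by apply: differentiableD => //; exact: differentiableZ.
rewrite !grad_penalty_joint// opprD addrACA -scalerBr mulrDl.
rewrite (le_trans (ler_enormD _ _))// lerD// enormZ ger0_norm// -mulrA.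
by rewrite ler_wpM2l.
Qed.

Lemma grad_y_penalty s f g x y :
  (forall w, differentiable (joint f) w) -> (forall w, differentiable (joint g) w) ->
  grad_y (penalty s f g) x y = s *: grad_y f x y + grad_y g x y.
Proof.
move=> df dg; have := grad_penalty_joint s (row_mx x y) df dg.
rewrite !grad_joint//; last first.
  move=> w; rewrite (_ : joint _ = s \*: joint f + joint g); last by apply/funext.
  by apply: differentiableD => //; exact: differentiableZ.
by rewrite scale_row_mx add_row_mx => /eq_row_mx[].
Qed.

Lemma grad_x_penalty s f g x y :
  (forall w, differentiable (joint f) w) -> (forall w, differentiable (joint g) w) ->
  grad_x (penalty s f g) x y = s *: grad_x f x y + grad_x g x y.
Proof.
move=> df dg; have := grad_penalty_joint s (row_mx x y) df dg.
rewrite !grad_joint//; last first.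
  move=> w; rewrite (_ : joint _ = s \*: joint f + joint g); last by apply/funext.
  by apply: differentiableD => //; exact: differentiableZ.
by rewrite scale_row_mx add_row_mx => /eq_row_mx[].
Qed.

Lemma penalty0 f g : penalty 0 f g = g.
Proof. by apply/funext => x; apply/funext => y; rewrite /penalty mul0r add0r. Qed.

End PartialGradients.

(** * Dependence of minimizers and gaps on the parameter *)

Section ValueFunction.
Context {R : realType} {dx dy : nat}.
Variables (h : 'rV[R]_dx -> 'rV[R]_dy -> R) (L mu : R).
Hypotheses (L_gt0 : 0 < L) (mu_gt0 : 0 < mu).
Hypotheses (hL : lipschitz_grad L (joint h)) (hPL : forall x, PL mu (h x)).

Let hLy x : lipschitz_grad L (h x) := lipschitz_grad_snd hL x.

(** At a minimizer for [x] the gradient in [y] vanishes, so for [x'] it is at most [L * |x - x'|];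
    the error bound then finds [y']. *)
Lemma argmin_near_argmin x x' y : argmin (h x) y ->
  exists2 y', argmin (h x') y' & enorm (y - y') <= 2 * L / mu * enorm (x - x').
Proof.
move=> hy; have [y' hy' yy'] := argmin_near_grad L_gt0 mu_gt0 (hLy x') (hPL x') y.
exists y' => //; rewrite (le_trans yy')//.
have -> : 2 * L / mu * enorm (x - x') = 2 / mu * (L * enorm (x - x')) by ring.
rewrite ler_wpM2l//; first by rewrite divr_ge0// ltW.
have := enorm_grad_y_sub_l hL x x' y.
by rewrite [grad_y h x y](grad_argmin L_gt0 (hLy x) (hPL x) hy) sub0r enormN.
Qed.

Let V x := inf (range (h x)).

(** The distance from [y] to a minimizer for [x'] is split through a minimizer for [x] near [y], and
    smoothness turns it back into a gap. The gap may thus grow by a factor of the order of the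
    condition number, which the inner loops have to win back. *)
Lemma gap_move x x' y :
  h x' y - V x' <=
    8 * L / mu * (h x y - V x) + 4 * L ^+ 3 / mu ^+ 2 * enorm (x - x') ^+ 2.
Proof.
have [y1 hy1 yy1] := argmin_near_gap L_gt0 mu_gt0 (hLy x) (hPL x) y.
have [y2 hy2 y12] := argmin_near_argmin x' hy1.
rewrite (le_trans (gap_le_dist_argmin L_gt0 (hLy x') (hPL x') y hy2))//.
have d2 : enorm (y - y2) ^+ 2 <= 2 * enorm (y - y1) ^+ 2 + 2 * enorm (y1 - y2) ^+ 2.
  have : enorm (y - y2) ^+ 2 <= (enorm (y - y1) + enorm (y1 - y2)) ^+ 2.
    by rewrite ler_pXn2r ?nnegrE ?addr_ge0 ?enorm_ge0// ler_enorm_trans.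
  by have := sqr_ge0 (enorm (y - y1) - enorm (y1 - y2)); nra.
have y12s : enorm (y1 - y2) ^+ 2 <= (2 * L / mu * enorm (x - x')) ^+ 2.
  by rewrite ler_pXn2r ?nnegrE ?enorm_ge0// (le_trans _ y12) ?enorm_ge0.
rewrite (@le_trans _ _ (L / 2 * (2 * (8 / mu * (h x y - V x))
    + 2 * (2 * L / mu * enorm (x - x')) ^+ 2)))//.
  by rewrite ler_wpM2l ?divr_ge0 ?(ltW L_gt0)// (le_trans d2)// lerD// ler_wpM2l.
by rewrite le_eqVlt; apply/orP; left; apply/eqP; field; rewrite gt_eqF.
Qed.

(* Danskin: both gradients are the gradient of the value function V. *)
Lemma grad_x_argmin_eq x y1 y2 : argmin (h x) y1 -> argmin (h x) y2 ->
  grad_x h x y1 = grad_x h x y2.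
Proof.
suff le y y' : argmin (h x) y -> argmin (h x) y' ->
    forall v, dot (grad_x h x y - grad_x h x y') v <= 0.
  move=> hy1 hy2; apply/subr0_eq/enorm0_eq0/eqP; rewrite -sqrf_eq0 enorm_sqr.
  by rewrite eq_le le // dot_ge0.
move=> hy hy' v; apply/ler_addgt0Pr => e e0; rewrite add0r.
pose k := 2 * L / mu.
have k0 : 0 <= k by rewrite divr_ge0 ?mulr_ge0// ltW.
pose C := L * (1 + k ^+ 2) * enorm v ^+ 2.
have C0 : 0 <= C.
  by rewrite mulr_ge0 ?sqr_ge0// mulr_ge0 ?(ltW L_gt0)// addr_ge0 ?sqr_ge0.
have C1 : 0 < C + 1 by lra.
pose t := e / (C + 1); have t0 : 0 < t by rewrite divr_gt0.
set x' := x + t *: v.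
have [z hz yz] := argmin_near_argmin x' hy.
have T1 := taylor1_joint hL x y x' z.
have T2 := taylor1_joint hL x y' x' y'.
have gy := grad_argmin L_gt0 (hLy x) (hPL x) hy.
rewrite subrr dot0r enorm0 expr0n addr0 subr0 in T2.
rewrite [grad_y h x y]gy dot0l subr0 in T1.
have yz2 : enorm (z - y) ^+ 2 <= k ^+ 2 * (t ^+ 2 * enorm v ^+ 2).
  rewrite -!exprMn; have ktv : 0 <= k * (t * enorm v).
    by rewrite mulr_ge0// mulr_ge0 ?enorm_ge0// ltW.
  rewrite ler_pXn2r ?nnegrE ?enorm_ge0//.
  rewrite enormC (le_trans yz)// ler_wpM2l// enormC /x' addrAC subrr add0r.
  by rewrite enormZ gtr0_norm.
have xx : enorm (x' - x) ^+ 2 = t ^+ 2 * enorm v ^+ 2.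
  by rewrite /x' addrAC subrr add0r enormZ gtr0_norm// exprMn.
have xE : x' - x = t *: v by rewrite /x' addrAC subrr add0r.
(* [h x] takes the same value at [y] and [y'], and [h x' z <= h x' y']. Comparing the expansions of
   these two values in [t] bounds the difference of the slopes by a term of order [t]. *)
have hzy := hz y'; have hyy := hy y'; have hyy' := hy' y.
have Lyz : L / 2 * enorm (z - y) ^+ 2 <= L / 2 * (k ^+ 2 * (t ^+ 2 * enorm v ^+ 2)).
  by apply: ler_wpM2l yz2; rewrite divr_ge0// ltW.
have Lk0 : 0 <= L * (k ^+ 2 * (t ^+ 2 * enorm v ^+ 2)).
  by rewrite mulr_ge0 ?(ltW L_gt0)// mulr_ge0 ?sqr_ge0// mulr_ge0 ?sqr_ge0.
have key : t * dot (grad_x h x y - grad_x h x y') v <= t * (t * C).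
  move: T1 T2; rewrite !ler_norml => /andP[a1 _] /andP[_ b2].
  rewrite xx xE !dotZr in a1 b2; rewrite dotBl.
  have -> : t * (t * C) = L * (t ^+ 2 * enorm v ^+ 2)
       + L * (k ^+ 2 * (t ^+ 2 * enorm v ^+ 2)) by rewrite /C; ring.
  by rewrite mulrDr in a1; lra.
rewrite ler_pM2l// in key; rewrite (le_trans key)//.
have : t * (C + 1) = e by rewrite /t divfK// gt_eqF.
by nra.
Qed.

End ValueFunction.

(** * The hyper-objective, its gradient and the bias of the estimator *)

Section HyperObjective.
Context {R : realType} {dx dy : nat}.
Variables (f g : 'rV[R]_dx -> 'rV[R]_dy -> R) (mu Cf Lf Lg rhof rhog sbar : R).
Hypothesis SA : standing_assumption f g mu Cf Lf Lg rhof rhog sbar.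

Variables (l k : R).
Hypotheses (Cf_le : Cf <= l) (Lf_le : Lf <= l) (Lg_le : Lg <= l) (rhog_le : rhog <= l).
Hypotheses (lE : l = k * mu) (k_ge1 : 1 <= k).

Let mu_gt0 : 0 < mu := sa_mu_gt0 SA.
Let Lf_gt0 : 0 < Lf := sa_Lf_gt0 SA.
Let Lg_gt0 : 0 < Lg := sa_Lg_gt0 SA.
Let df : forall w, differentiable (joint f) w := (sa_f_grad SA).1.
Let dg : forall w, differentiable (joint g) w := (sa_g_grad SA).1.
Let k_gt0 : 0 < k. Proof. exact: lt_le_trans ltr01 k_ge1. Qed.
Let l_gt0 : 0 < l. Proof. exact: lt_le_trans Lg_gt0 Lg_le. Qed.

(** [s <= sbar] provides the PL inequality for the penalty. [s * Lf <= Lg] keeps its smoothness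
    constant at most [2 * l] and gives [Lf <= l / s], so that the part of the estimator coming from
    [f] is no worse than the parts divided by [s]. *)
Definition admissible s := [/\ 0 < s, s <= sbar & s * Lf <= Lg].

Lemma PL_penalty s x : admissible s -> PL mu (penalty s f g x).
Proof. by move=> [s0 sb _]; apply: (sa_PL SA); rewrite ltW. Qed.

Lemma PL_lower x : PL mu (g x).
Proof.
have s0 : (0 : R) <= 0 <= sbar by apply/andP; split; rewrite ?(ltW (sa_sbar_gt0 SA)).
by have := sa_PL SA s0 x; rewrite penalty0.
Qed.

Lemma penalty_smooth s : admissible s ->
  lipschitz_grad (s * Lf + Lg) (joint (penalty s f g)).
Proof.
move=> [s0 _ _].
exact: lipschitz_grad_penalty (ltW s0) (sa_f_grad SA) (sa_g_grad SA).
Qed.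

Lemma penalty_const_gt0 s : admissible s -> 0 < s * Lf + Lg.
Proof. by move=> [s0 _ _]; rewrite addr_gt0// mulr_gt0. Qed.

Lemma penalty_const_le s : admissible s -> s * Lf + Lg <= 2 * l.
Proof. by move=> [_ _ sL]; have := Lg_le; lra. Qed.

Lemma enorm_grad_y_le x y : enorm (grad_y f x y) <= Cf.
Proof.
apply: enorm_grad_le; first exact: ltW (sa_Cf_gt0 SA).
  by have [+ _] := lipschitz_grad_snd (sa_f_grad SA) x; apply.
by move=> y'; exact: (sa_f_lip SA).
Qed.

Lemma mul_Cf_le s : 0 <= s -> 2 / mu * (s * Cf) <= 2 * k * s.
Proof.
move=> s0; have -> : 2 * k * s = 2 / mu * (s * l).
  by rewrite lE; field; rewrite gt_eqF.
by rewrite ler_wpM2l ?divr_ge0 ?(ltW mu_gt0)// ler_wpM2l.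
Qed.

(** At a minimizer of [g x] the penalty has gradient [s *: grad_y f x y], of norm at most [s * Cf];
    the error bound does the rest. *)
Lemma argmin_penalty_near s x y : admissible s -> argmin (g x) y ->
  exists2 y', argmin (penalty s f g x) y' & enorm (y - y') <= 2 * k * s.
Proof.
move=> As hy; have [s0 _ _] := As.
have Ls := lipschitz_grad_snd (penalty_smooth As) x.
have [y' hy' yy'] := argmin_near_grad (penalty_const_gt0 As) mu_gt0 Ls (PL_penalty x As) y.
exists y' => //; rewrite (le_trans yy')// (le_trans _ (mul_Cf_le (ltW s0)))//.
rewrite ler_wpM2l ?divr_ge0 ?(ltW mu_gt0)//.
rewrite -[grad _ _]/(grad_y _ _ _) grad_y_penalty//.
have -> : grad_y g x y = 0.
  exact (grad_argmin Lg_gt0 (lipschitz_grad_snd (sa_g_grad SA) x) (PL_lower x) hy).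
by rewrite addr0 enormZ gtr0_norm// ler_wpM2l ?(ltW s0)// enorm_grad_y_le.
Qed.

Lemma argmin_lower_near x x' y : argmin (g x) y ->
  exists2 y', argmin (g x') y' & enorm (y - y') <= 2 * k * enorm (x - x').
Proof.
move=> hy.
have [y' hy' yy'] := argmin_near_argmin Lg_gt0 mu_gt0 (sa_g_grad SA) PL_lower x' hy.
exists y' => //; rewrite (le_trans yy')// ler_wpM2r ?enorm_ge0//.
by rewrite ler_pdivrMr// -mulrA -lE ler_wpM2l.
Qed.

Let s1 := Num.min sbar (Lg / Lf).

Lemma admissible_min s : 0 < s <= s1 -> admissible s.
Proof. by rewrite le_min => /and3P[s0 ? ?]; split; rewrite -?ler_pdivlMr. Qed.

Lemma s1_gt0 : 0 < s1.
Proof. by rewrite lt_min (sa_sbar_gt0 SA) divr_gt0. Qed.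

(* A minimizer of [penalty s f g x] within O(s) of y1 has upper-level value at most
   [f x y2]; let s tend to 0. *)
Lemma upper_const_on_argmin x y1 y2 : argmin (g x) y1 -> argmin (g x) y2 ->
  f x y1 = f x y2.
Proof.
suff le y y' : argmin (g x) y -> argmin (g x) y' -> f x y <= f x y'.
  by move=> ? ?; apply/eqP; rewrite eq_le !le.
move=> hy hy'; apply/ler_addgt0Pr => e e0.
pose C := 2 * k * Cf; have C0 : 0 < C by rewrite !mulr_gt0// (sa_Cf_gt0 SA).
pose s := Num.min s1 (e / C).
have s0 : 0 < s by rewrite lt_min s1_gt0 divr_gt0.
have Cs : s * C <= e by rewrite -ler_pdivlMr// ge_min lexx orbT.
have As : admissible s by apply: admissible_min; rewrite s0 ge_min lexx.
have [ys hys yys] := argmin_penalty_near As hy.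
have fy' : f x ys <= f x y'.
  by have := hys y'; have := hy' ys; rewrite /penalty => a b; rewrite -(ler_pM2l s0); lra.
have := sa_f_lip SA x y ys; rewrite ler_norml => /andP[_].
have : Cf * enorm (y - ys) <= Cf * (2 * k * s).
  by rewrite ler_wpM2l// ltW// (sa_Cf_gt0 SA).
have -> : Cf * (2 * k * s) = s * C by rewrite /C; ring.
by lra.
Qed.

Lemma hyperobjE x y : argmin (g x) y -> hyperobj f g x = f x y.
Proof.
move=> hy; rewrite /hyperobj (_ : _ @` _ = [set f x y]) ?inf1//.
apply/seteqP; split=> [_ [z hz <-]|_ ->]; last by exists y.
exact: upper_const_on_argmin.
Qed.

Lemma hypergrad_estE s x y z : s != 0 ->
  hypergrad_est f g s x y z = s^-1 *: (grad_x (penalty s f g) x y - grad_x g x z).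
Proof.
by move=> s0; rewrite grad_x_penalty// -addrA [RHS]scalerDr scalerA mulVf// scale1r.
Qed.

(** Lets minimizers be chosen freely: one selection is fixed to build the limit gradient, whereas
    the error analysis needs minimizers near the iterates. *)
Lemma hypergrad_est_argmin s x y y' z z' : admissible s ->
  argmin (penalty s f g x) y -> argmin (penalty s f g x) y' ->
  argmin (g x) z -> argmin (g x) z' ->
  hypergrad_est f g s x y z = hypergrad_est f g s x y' z'.
Proof.
move=> As hy hy' hz hz'; have [s0 _ _] := As; have sn : s != 0 by rewrite gt_eqF.
rewrite !hypergrad_estE//; congr (_ *: (_ - _)).
- apply: (grad_x_argmin_eq (penalty_const_gt0 As) mu_gt0 (penalty_smooth As)) => // x'.
  exact: PL_penalty.
- exact: (grad_x_argmin_eq Lg_gt0 mu_gt0 (sa_g_grad SA) PL_lower).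
Qed.

(* Write h = (x' - x, y0' - y0) with y0' a minimizer of g x' and e = (0, ys - y0).
   The y-components of grad g vanish at both ends of h, so its Hessian H satisfies
   <h H, e> = O(|h|^2 |e|); on the other hand e H is the difference of grad g along
   e, whose y-component is - s grad_y f.  The symmetry of H turns the unknown
   <grad_y f, y0' - y0> into the inner product of x' - x with the estimator. *)
Lemma hyperobj_expansion s x x' y0 ys : admissible s ->
  argmin (g x) y0 -> argmin (penalty s f g x) ys -> enorm (y0 - ys) <= 2 * k * s ->
  `|hyperobj f g x' - hyperobj f g x - dot (hypergrad_est f g s x ys y0) (x' - x)|
    <= 13 * (l * k ^+ 3) * enorm (x' - x) ^+ 2 + 18 * (l * k ^+ 3) * s * enorm (x' - x).
Proof.
move=> As hy0 hys ey; have [s0 _ _] := As.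
have [y1 hy1 dy1] := argmin_lower_near x' hy0.
rewrite (hyperobjE hy0) (hyperobjE hy1).
set D := x' - x; set d := y1 - y0; set e := ys - y0.
set nD := enorm D.
have nD0 : 0 <= nD := enorm_ge0 _.
have nd : enorm d <= 2 * k * nD by rewrite /d /nD /D enormC (enormC x').
have ne : enorm e <= 2 * k * s by rewrite /e enormC.
pose h := row_mx D d; pose E := row_mx (0 : 'rV[R]_dx) e.
set p := row_mx x y0.
have k2 : 1 <= k ^+ 2 by rewrite exprn_ege1.
have nh2 : enorm h ^+ 2 <= 5 * k ^+ 2 * nD ^+ 2.
  rewrite enorm_row_mx -/nD.
  have : enorm d ^+ 2 <= (2 * k * nD) ^+ 2.
    by rewrite ler_pXn2r ?nnegrE ?enorm_ge0// (le_trans _ nd) ?enorm_ge0.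
  have : nD ^+ 2 <= k ^+ 2 * nD ^+ 2 by rewrite ler_peMl ?sqr_ge0.
  by rewrite !exprMn; lra.
have nh : enorm h <= 3 * k * nD.
  rewrite -(@ler_pXn2r _ 2) ?nnegrE ?enorm_ge0 ?mulr_ge0 ?(ltW k_gt0)//.
  rewrite (le_trans nh2)// !exprMn.
  have : 0 <= k ^+ 2 * nD ^+ 2 by rewrite mulr_ge0 ?sqr_ge0.
  by lra.
have nE : enorm E = enorm e by rewrite enorm_row_0mx.
have rho0 : 0 <= rhog := ltW (sa_rhog_gt0 SA).
have gy0 : grad_y g x y0 = 0.
  exact (grad_argmin Lg_gt0 (lipschitz_grad_snd (sa_g_grad SA) x) (PL_lower x) hy0).
have gy1 : grad_y g x' y1 = 0.
  exact (grad_argmin Lg_gt0 (lipschitz_grad_snd (sa_g_grad SA) x') (PL_lower x') hy1).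
have gys : grad_y g x ys = - (s *: grad_y f x ys).
  have := grad_argmin (penalty_const_gt0 As) (lipschitz_grad_snd (penalty_smooth As) x)
    (PL_penalty x As) hys.
  by rewrite -[grad _ _]/(grad_y _ _ _) grad_y_penalty// addrC => /addr0_eq <-; rewrite opprK.
have ph : p + h = row_mx x' y1.
  by rewrite add_row_mx ![_ + (_ - _)]addrC !subrK.
have pE : p + E = row_mx x ys.
  by rewrite add_row_mx addr0 [_ + (_ - _)]addrC subrK.
have T1 := taylor1_jacobian p h rho0 (sa_g_diff2 SA) (sa_g_hess SA).
have T2 := taylor1_jacobian p E rho0 (sa_g_diff2 SA) (sa_g_hess SA).
have sym := jacobian_grad_sym p h E rho0 dg (sa_g_diff2 SA) (sa_g_hess SA).
rewrite ph !grad_joint// gy0 gy1 in T1; rewrite pE !grad_joint// gy0 gys in T2.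
set J := 'J _ _ in T1 T2 sym.
set G1 := row_mx _ _ - row_mx _ _ in T1; set G2 := row_mx _ _ - row_mx _ _ in T2.
have G1E : dot G1 E = 0.
  by rewrite /G1 opp_row_mx add_row_mx subr0 dot_row_mx dot0r dot0l addr0.
have G2h : dot G2 h = dot (grad_x g x ys - grad_x g x y0) D - s * dot (grad_y f x ys) d.
  by rewrite /G2 opp_row_mx add_row_mx subr0 dot_row_mx dotNl dotZl.
have lk3 : 0 <= l * k ^+ 3 by rewrite mulr_ge0 ?exprn_ge0 ?ltW.
have B1 : `|dot (G1 - h *m J) E| <= 10 * (l * k ^+ 3) * s * nD ^+ 2.
  rewrite (le_trans (dot_le _ _))// nE.
  rewrite (@le_trans _ _ (l * (5 * k ^+ 2 * nD ^+ 2) * (2 * k * s)))//; last first.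
    by rewrite le_eqVlt; apply/orP; left; apply/eqP; ring.
  apply: ler_pM; rewrite ?enorm_ge0//; rewrite (le_trans T1)//.
  by apply: ler_pM; rewrite ?sqr_ge0.
have B2 : `|dot (G2 - E *m J) h| <= 12 * (l * k ^+ 3) * s ^+ 2 * nD.
  rewrite (le_trans (dot_le _ _))//.
  rewrite (@le_trans _ _ (l * (2 * k * s) ^+ 2 * (3 * k * nD)))//; last first.
    by rewrite le_eqVlt; apply/orP; left; apply/eqP; ring.
  apply: ler_pM; rewrite ?enorm_ge0//; rewrite (le_trans T2)// nE.
  apply: ler_pM; rewrite ?sqr_ge0//.
  by rewrite ler_pXn2r ?nnegrE ?enorm_ge0// (le_trans _ ne) ?enorm_ge0.
set c := dot (grad_y f x ys) d; set b := dot (grad_x g x ys - grad_x g x y0) D.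
(* [E] has length O(s), so both errors carry a spare factor [s] and the division by [s] is
   affordable. *)
have B3 : `|s^-1 * b - c| <= 12 * (l * k ^+ 3) * s * nD + 10 * (l * k ^+ 3) * nD ^+ 2.
  rewrite -(ler_pM2l s0) -{1}(gtr0_norm s0) -normrM.
  have -> : s * (s^-1 * b - c) = dot (G2 - E *m J) h - dot (G1 - h *m J) E.
    by rewrite (dotBl G2) (dotBl G1) G1E G2h sym -/b -/c; field; rewrite gt_eqF.
  rewrite (le_trans (ler_normB _ _))// (le_trans (lerD B2 B1))//.
  by rewrite le_eqVlt; apply/orP; left; apply/eqP; ring.
have T3 := taylor1_joint (sa_f_grad SA) x y0 x' y1.
have B4 : `|dot (grad_x f x y0 - grad_x f x ys) D| <= 2 * (l * k ^+ 3) * s * nD.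
  rewrite (le_trans (dot_le _ _))//.
  rewrite (@le_trans _ _ (l * (2 * k * s) * nD))//.
    apply: ler_wpM2r => //.
    rewrite (le_trans (enorm_grad_x_sub_r (sa_f_grad SA) _ _ _))//.
    by apply: ler_pM; rewrite ?enorm_ge0// ltW.
  have -> : l * (2 * k * s) * nD = 2 * (l * k) * s * nD by ring.
  rewrite ler_wpM2r// ler_wpM2r ?(ltW s0)// ler_wpM2l// ler_wpM2l ?(ltW l_gt0)//.
  by rewrite exprS ler_peMr// ltW.
have B5 : `|dot (grad_y f x y0 - grad_y f x ys) d| <= 4 * (l * k ^+ 3) * s * nD.
  rewrite (le_trans (dot_le _ _))//.
  rewrite (@le_trans _ _ (l * (2 * k * s) * (2 * k * nD)))//.
    apply: ler_pM; rewrite ?enorm_ge0//.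
    rewrite (le_trans (enorm_grad_y_sub_r (sa_f_grad SA) _ _ _))//.
    by apply: ler_pM; rewrite ?enorm_ge0// ltW.
  have -> : l * (2 * k * s) * (2 * k * nD) = 4 * (l * k ^+ 2) * s * nD by ring.
  rewrite ler_wpM2r// ler_wpM2r ?(ltW s0)// ler_wpM2l// ler_wpM2l ?(ltW l_gt0)//.
  by rewrite (exprSr k 2) ler_peMr ?sqr_ge0.
have B6 : Lf / 2 * (enorm (x' - x) ^+ 2 + enorm (y1 - y0) ^+ 2)
    <= 3 * (l * k ^+ 3) * nD ^+ 2.
  rewrite -/D -/d -enorm_row_mx -/h.
  rewrite (@le_trans _ _ (l / 2 * (5 * k ^+ 2 * nD ^+ 2)))//.
    apply: ler_pM; rewrite ?sqr_ge0 ?divr_ge0 ?(ltW Lf_gt0)//.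
    by rewrite ler_wpM2r.
  have -> : l / 2 * (5 * k ^+ 2 * nD ^+ 2) = (5 / 2) * (l * k ^+ 2 * nD ^+ 2) by field.
  have : l * k ^+ 2 * nD ^+ 2 <= l * k ^+ 3 * nD ^+ 2.
    rewrite ler_wpM2r ?sqr_ge0// ler_wpM2l ?(ltW l_gt0)//.
    by rewrite (exprSr k 2) ler_peMr ?sqr_ge0.
  have : 0 <= l * k ^+ 2 * nD ^+ 2 by rewrite mulr_ge0 ?sqr_ge0// mulr_ge0 ?sqr_ge0// ltW.
  by lra.
(* The constants add up: [13 = 10 + 3] from [B3] and [B6], and [18 = 12 + 2 + 4] from [B3], [B4] and
   [B5]. *)
have {T3} := le_trans T3 B6; rewrite -/D -/d => T3.
rewrite /hypergrad_est dotDl dotZl -/b.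
move: T3 B3 B4 B5; rewrite !dotBl -/c.
rewrite !ler_norml => /andP[a1 a2] /andP[b1 b2] /andP[c1 c2] /andP[d1 d2].
by apply/andP; split; lra.
Qed.

Lemma hyperobj_smooth x :
  [/\ differentiable (hyperobj f g) x,
      forall x', `|hyperobj f g x' - hyperobj f g x
                   - dot (grad (hyperobj f g) x) (x' - x)|
        <= 13 * (l * k ^+ 3) * enorm (x' - x) ^+ 2
    & forall s y z, admissible s -> argmin (penalty s f g x) y -> argmin (g x) z ->
        enorm (hypergrad_est f g s x y z - grad (hyperobj f g) x)
          <= 18 * (l * k ^+ 3) * s].
Proof.
have [[y0 hy0] _] := PL_lower x.
(* One minimizer is chosen for every [s]; where [s] is not admissible, [y0] is a dummy value. *)
have ex s : {ys | admissible s -> argmin (penalty s f g x) ys /\ enorm (y0 - ys) <= 2 * k * s}.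
  apply: cid; have [As|nAs] := pselect (admissible s); last by exists y0.
  by have [ys ? ?] := argmin_penalty_near As hy0; exists ys.
have lk3 : 0 <= 18 * (l * k ^+ 3) by rewrite mulr_ge0// mulr_ge0 ?exprn_ge0 ?ltW.
(* The lemma on families needs a whole interval of admissible parameters. For the error at a given
   [s] the interval up to [s] itself is used; the limit is the same gradient each time. *)
suff main t : 0 < t -> (forall s, 0 < s <= t -> admissible s) ->
  [/\ differentiable (hyperobj f g) x,
      forall x', `|hyperobj f g x' - hyperobj f g x
                   - dot (grad (hyperobj f g) x) (x' - x)|
        <= 13 * (l * k ^+ 3) * enorm (x' - x) ^+ 2
    & forall s y z, 0 < s <= t -> argmin (penalty s f g x) y -> argmin (g x) z ->
        enorm (hypergrad_est f g s x y z - grad (hyperobj f g) x)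
          <= 18 * (l * k ^+ 3) * s].
  have [D Q _] := main _ s1_gt0 admissible_min; split=> // s y z As hy hz.
  have [s0 sb sL] := As; have [] := main s s0.
    move=> s' /andP[s'0 s's]; split=> //; first exact: le_trans sb.
    by rewrite (le_trans _ sL)// ler_wpM2r// ltW.
  by move=> _ _; apply; rewrite ?s0 ?lexx.
move=> t0 tA.
have [//|D Q C] := @differentiable_quadratic_family _ _ (hyperobj f g) x t
  (13 * (l * k ^+ 3)) (18 * (l * k ^+ 3))
  (fun s => hypergrad_est f g s x (sval (ex s)) y0) t0 lk3.
  move=> s /tA As x'; have [hys nys] := svalP (ex s) As.
  exact: hyperobj_expansion.
split=> // s y z st hy hz; have := C s st; have As := tA _ st.
have [hys _] := svalP (ex s) As.
by rewrite (hypergrad_est_argmin As hys hy hy0 hz).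
Qed.

End HyperObjective.

(** * Inner loops, tracking of the minimizers and the Lyapunov descent *)

Lemma gradient_descent_contraction (R : realType) n (h : 'rV[R]_n -> R) (L mu t : R) K x :
  0 < L -> lipschitz_grad L h -> PL mu h -> 0 <= t <= L^-1 -> t * mu <= 1 ->
  h (iter K (fun z => z - t *: grad h z) x) - inf (range h)
    <= (1 - t * mu) ^+ K * (h x - inf (range h)).
Proof.
move=> L0 hL hPL tL tmu; elim: K => [|K IH]; first by rewrite expr0 mul1r.
rewrite /= (le_trans (gradient_step_contraction L0 hL hPL _ tL))// exprS -mulrA.
by rewrite ler_wpM2l// subr_ge0.
Qed.

Section Tracking.
Context {R : realType} {dx dy : nat}.
Variables (f g : 'rV[R]_dx -> 'rV[R]_dy -> R) (mu Cf Lf Lg rhof rhog sbar : R).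
Hypothesis SA : standing_assumption f g mu Cf Lf Lg rhof rhog sbar.

Variables (l k s : R).
Hypotheses (Cf_le : Cf <= l) (Lf_le : Lf <= l) (Lg_le : Lg <= l) (rhog_le : rhog <= l).
Hypotheses (lE : l = k * mu) (k_ge1 : 1 <= k) (mu_le_Lg : mu <= Lg).
Hypothesis As : admissible Lf Lg sbar s.

Let mu_gt0 : 0 < mu := sa_mu_gt0 SA.
Let Lf_gt0 : 0 < Lf := sa_Lf_gt0 SA.
Let Lg_gt0 : 0 < Lg := sa_Lg_gt0 SA.
Let df : forall w, differentiable (joint f) w := (sa_f_grad SA).1.
Let dg : forall w, differentiable (joint g) w := (sa_g_grad SA).1.
Let k_gt0 : 0 < k. Proof. exact: lt_le_trans ltr01 k_ge1. Qed.
Let l_gt0 : 0 < l. Proof. exact: lt_le_trans Lg_gt0 Lg_le. Qed.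
Let s_gt0 : 0 < s. Proof. by case: As. Qed.

Let t := (s * Lf + Lg)^-1.
Let Ls_gt0 := penalty_const_gt0 SA As.

Definition upper_gap x y := penalty s f g x y - inf (range (penalty s f g x)).
Definition lower_gap x z := g x z - inf (range (g x)).
Definition tracking_gap x y z := upper_gap x y + lower_gap x z.

Lemma upper_gap_ge0 x y : 0 <= upper_gap x y.
Proof. by rewrite subr_ge0; exact (inf_range_le (PL_penalty SA x As) y). Qed.

Lemma lower_gap_ge0 x z : 0 <= lower_gap x z.
Proof. by rewrite subr_ge0; exact (inf_range_le (PL_lower SA x) z). Qed.

Lemma step_mu_le1 : t * mu <= 1.
Proof.
rewrite mulrC ler_pdivrMr// mul1r (le_trans mu_le_Lg)// lerDr.
by rewrite mulr_ge0// ltW.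
Qed.

Lemma upper_gap_inner K x y :
  upper_gap x (inner_y f g t s K x y) <= (1 - t * mu) ^+ K * upper_gap x y.
Proof.
have -> : inner_y f g t s K x y = iter K (fun z => z - t *: grad (penalty s f g x) z) y.
  apply: eq_iter => z.
  by rewrite -[grad (penalty s f g x) z]/(grad_y _ _ _) grad_y_penalty.
apply: (gradient_descent_contraction K y Ls_gt0
  (lipschitz_grad_snd (penalty_smooth SA As) x) (PL_penalty SA x As)).
  by rewrite lexx invr_ge0 ltW.
exact: step_mu_le1.
Qed.

Lemma lower_gap_inner K x z :
  lower_gap x (inner_z g t K x z) <= (1 - t * mu) ^+ K * lower_gap x z.
Proof.
apply: (gradient_descent_contraction K z Lg_gt0
  (lipschitz_grad_snd (sa_g_grad SA) x) (PL_lower SA x)).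
  rewrite invr_ge0 ltW//= lef_pV2 ?posrE// lerDr.
  by rewrite mulr_ge0// ltW.
exact: step_mu_le1.
Qed.

(** [gap_move] for both functions, with smoothness constants at most [2 * l] and [l]: hence
    [16 = 8 * 2] and [36 = 4 * 2 ^ 3 + 4]. *)
Lemma tracking_gap_move x x' y z : tracking_gap x' y z <=
  16 * k * tracking_gap x y z + 36 * (l * k ^+ 2) * enorm (x - x') ^+ 2.
Proof.
have Ls_le : s * Lf + Lg <= 2 * l := penalty_const_le Lg_le As.
have U := gap_move Ls_gt0 mu_gt0 (penalty_smooth SA As)
  (fun x => PL_penalty SA x As) x x' y.
have Lw := gap_move Lg_gt0 mu_gt0 (sa_g_grad SA) (PL_lower SA) x x' z.
rewrite -/(upper_gap x y) -/(upper_gap x' y) in U.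
rewrite -/(lower_gap x z) -/(lower_gap x' z) in Lw.
set L := s * Lf + Lg in Ls_le U.
have L0 : 0 < L by exact: Ls_gt0.
have U1 : 8 * L / mu * upper_gap x y <= 16 * k * upper_gap x y.
  rewrite ler_wpM2r ?upper_gap_ge0// ler_pdivrMr// -mulrA -lE; lra.
have Lw1 : 8 * Lg / mu * lower_gap x z <= 16 * k * lower_gap x z.
  rewrite ler_wpM2r ?lower_gap_ge0// ler_pdivrMr// -mulrA -lE.
  by have := Lg_le; have := l_gt0; lra.
have D0 := sqr_ge0 (enorm (x - x')).
have cube a : 0 <= a -> a <= 2 * l -> a ^+ 3 <= 8 * l ^+ 3.
  move=> a0 al; have -> : 8 * l ^+ 3 = (2 * l) ^+ 3 by ring.
  by rewrite ler_pXn2r ?nnegrE// (le_trans a0).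
have U2 : 4 * L ^+ 3 / mu ^+ 2 * enorm (x - x') ^+ 2
    <= 32 * (l * k ^+ 2) * enorm (x - x') ^+ 2.
  rewrite ler_wpM2r// ler_pdivrMr ?exprn_gt0//.
  have -> : 32 * (l * k ^+ 2) * mu ^+ 2 = 4 * (8 * l ^+ 3).
    by rewrite -mulrA -mulrA -exprMn -lE; ring.
  by rewrite ler_wpM2l// cube// ltW.
have Lw2 : 4 * Lg ^+ 3 / mu ^+ 2 * enorm (x - x') ^+ 2
    <= 4 * (l * k ^+ 2) * enorm (x - x') ^+ 2.
  rewrite ler_wpM2r// ler_pdivrMr ?exprn_gt0//.
  have -> : 4 * (l * k ^+ 2) * mu ^+ 2 = 4 * l ^+ 3.
    by rewrite -mulrA -mulrA -exprMn -lE; ring.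
  by rewrite ler_wpM2l// ler_pXn2r ?nnegrE ?(ltW Lg_gt0) ?(ltW l_gt0)//.
by rewrite /tracking_gap; lra.
Qed.

(** Some minimizer of the penalty lies within [r + 2 * k * s] of the common starting point. The
    factor [5 / 2] is 2 from the square of this bound plus [1 / 2] from the lower level. *)
Lemma tracking_gap_init x0 y0 r : 0 <= r ->
  (exists2 y, argmin (g x0) y & enorm (y0 - y) <= r) ->
  tracking_gap x0 y0 y0 <= l * (5 / 2 * r ^+ 2 + 8 * (k * s) ^+ 2).
Proof.
move=> r0 [y hy yr].
have Ls_le : s * Lf + Lg <= 2 * l := penalty_const_le Lg_le As.
have [ys hys yys] := argmin_penalty_near SA Cf_le lE As hy.
have sq (u v : R) : 0 <= u -> u <= v -> u ^+ 2 <= v ^+ 2.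
  by move=> u0 uv; rewrite ler_pXn2r ?nnegrE// (le_trans u0).
have U : upper_gap x0 y0 <= l * (2 * r ^+ 2 + 8 * (k * s) ^+ 2).
  have /le_trans -> // := gap_le_dist_argmin Ls_gt0
    (lipschitz_grad_snd (penalty_smooth SA As) x0) (PL_penalty SA x0 As) y0 hys.
  apply: ler_pM; rewrite ?sqr_ge0 ?divr_ge0 ?(ltW Ls_gt0)//; first by lra.
  rewrite (@le_trans _ _ ((r + 2 * k * s) ^+ 2))//.
    by rewrite sq ?enorm_ge0// (le_trans (ler_enorm_trans y _ _))// lerD.
  by have := sqr_ge0 (r - 2 * k * s); lra.
have Lw : lower_gap x0 y0 <= l * (1 / 2 * r ^+ 2).
  have /le_trans -> // := gap_le_dist_argmin Lg_gt0
    (lipschitz_grad_snd (sa_g_grad SA) x0) (PL_lower SA x0) y0 hy.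
  rewrite [leRHS]mulrA; apply: ler_pM; rewrite ?sqr_ge0 ?divr_ge0 ?(ltW Lg_gt0)//.
    by have := Lg_le; lra.
  by rewrite sq ?enorm_ge0.
by rewrite /tracking_gap; lra.
Qed.

(** The estimator is compared with its value [P] at minimizers near [y] and [z]. It differs from [P]
    by at most [2 * (l / s)] times the two distances, whose squares are controlled by the gaps; [P]
    itself is off by [18 * (l * k ^+ 3) * s]. Squaring the sum doubles both squares:
    [648 = 2 * 18 ^ 2] and [128 = 2 * 64]. *)
Lemma hypergrad_est_error x y z :
  enorm (hypergrad_est f g s x y z - grad (hyperobj f g) x) ^+ 2 <=
    648 * (l * k ^+ 3 * s) ^+ 2 + 128 * (l * k) / s ^+ 2 * tracking_gap x y z.
Proof.
have sq2 (u v : R) : (u + v) ^+ 2 <= 2 * v ^+ 2 + 2 * u ^+ 2.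
  by have := sqr_ge0 (u - v); lra.
have aux (u v : R) : 0 <= v -> u + u + v <= 2 * (u + v) by lra.
have [_ _ /(_ s) C] := hyperobj_smooth SA Cf_le Lf_le Lg_le rhog_le lE k_ge1 x.
have [y1 hy1 yy1] := argmin_near_gap Ls_gt0 mu_gt0
  (lipschitz_grad_snd (penalty_smooth SA As) x) (PL_penalty SA x As) y.
have [z1 hz1 zz1] := argmin_near_gap Lg_gt0 mu_gt0
  (lipschitz_grad_snd (sa_g_grad SA) x) (PL_lower SA x) z.
have {C} := C _ _ As hy1 hz1.
rewrite -/(upper_gap x y) in yy1; rewrite -/(lower_gap x z) in zz1.
set P := hypergrad_est f g s x y1 z1; set G := grad _ x => PG.
set a := enorm (y - y1) in yy1 *; set b := enorm (z - z1) in zz1 *.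
have a0 : 0 <= a := enorm_ge0 _; have b0 : 0 <= b := enorm_ge0 _.
have sLf : Lf <= l / s.
  by have [_ _ sL] := As; rewrite ler_pdivlMr// mulrC (le_trans sL).
have ls0 : 0 <= l / s by rewrite divr_ge0// ltW.
have PE : enorm (hypergrad_est f g s x y z - P) <= 2 * (l / s) * (a + b).
  have -> : hypergrad_est f g s x y z - P =
      (grad_x f x y - grad_x f x y1) + s^-1 *: (grad_x g x y - grad_x g x y1)
      - s^-1 *: (grad_x g x z - grad_x g x z1).
    by rewrite /P /hypergrad_est; apply/rowP => i; rewrite !mxE; ring.
  rewrite (le_trans (ler_enormB _ _))//.
  have E1 : enorm (grad_x f x y - grad_x f x y1) <= l / s * a.
    rewrite (le_trans (enorm_grad_x_sub_r (sa_f_grad SA) _ _ _))//.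
    by rewrite ler_wpM2r.
  have E2 u v : enorm (s^-1 *: (grad_x g x u - grad_x g x v)) <= l / s * enorm (u - v).
    rewrite enormZ gtr0_norm ?invr_gt0// mulrAC mulrC ler_wpM2r ?invr_ge0 ?(ltW s_gt0)//.
    rewrite (le_trans (enorm_grad_x_sub_r (sa_g_grad SA) _ _ _))//.
    by rewrite ler_wpM2r ?enorm_ge0.
  apply: le_trans (lerD (le_trans (ler_enormD _ _) (lerD E1 (E2 y y1))) (E2 z z1)) _.
  by rewrite -/a -/b -!mulrDr -mulrA mulrCA ler_wpM2l// aux.
set d := 2 * (l / s) * (a + b) in PE; set c := 18 * (l * k ^+ 3) * s in PG.
have d2 : d ^+ 2 <= 64 * (l * k) / s ^+ 2 * tracking_gap x y z.
  have -> : d ^+ 2 = 4 * (l ^+ 2 / s ^+ 2) * (a + b) ^+ 2.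
    by rewrite /d !exprMn exprVn; ring.
  have -> : 64 * (l * k) / s ^+ 2 * tracking_gap x y z =
      4 * (l ^+ 2 / s ^+ 2) * (2 * (8 / mu * upper_gap x y + 8 / mu * lower_gap x z)).
    rewrite /tracking_gap lE; field.
    by rewrite !gt_eqF.
  have Ua : a ^+ 2 <= 8 / mu * upper_gap x y by exact: yy1.
  have Lb : b ^+ 2 <= 8 / mu * lower_gap x z by exact: zz1.
  apply: ler_wpM2l; first by rewrite mulr_ge0// divr_ge0// sqr_ge0.
  by move: Ua Lb (sqr_ge0 (a - b)); lra.
have tri := ler_enorm_trans P (hypergrad_est f g s x y z) G.
have ed := le_trans tri (lerD PE PG).
have dc0 : 0 <= d + c by rewrite (le_trans (enorm_ge0 _) ed).
have c2 : c ^+ 2 = 324 * (l * k ^+ 3 * s) ^+ 2 by rewrite /c; ring.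
apply: (@le_trans _ _ ((d + c) ^+ 2)); first by rewrite ler_pXn2r ?nnegrE ?enorm_ge0.
rewrite (@le_trans _ _ (2 * c ^+ 2 + 2 * d ^+ 2))// ?sq2//.
rewrite c2 mulrA -natrM lerD2l.
have -> : 128 * (l * k) / s ^+ 2 = 2 * (64 * (l * k) / s ^+ 2) by ring.
by rewrite -mulrA ler_wpM2l.
Qed.

Variables (eps eta : R) (K : nat).
Let a := (1 - t * mu) ^+ K.
(* With this weight, lam times the gap pays for eta times the squared error. *)
Let lam := 128 * eta * (l * k) * a / s ^+ 2.
(** [s_eps] brings the bias term of the squared error below [eps ^+ 2 / 2]; [a_k] makes the
    contraction leave at most half of the gap after a move has enlarged it [16 * k] times; [a_s]
    bounds the cost of the move itself, weighted by [lam]. *)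
Hypotheses (eps_gt0 : 0 < eps) (etaE : eta = 64^-1 * (l^-1 * k ^- 3)).
Hypotheses (s_eps : 36 * (l * k ^+ 3 * s) <= eps).
Hypotheses (a_k : 32 * k * a <= 1) (a_s : 8 * a <= s ^+ 2).

Let eta_gt0 : 0 < eta.
Proof. by rewrite etaE !mulr_gt0 ?invr_gt0 ?exprn_gt0. Qed.

Let a_ge0 : 0 <= a.
Proof. by rewrite exprn_ge0// subr_ge0 step_mu_le1. Qed.

Let lam_ge0 : 0 <= lam.
Proof. by rewrite /lam !mulr_ge0 ?invr_ge0 ?sqr_ge0// ltW. Qed.

Definition lyapunov x y z := hyperobj f g x + lam * tracking_gap x y z.

(** The budget: polarization of [dot G v] yields [- eta / 2] times each of [|G|^2] and [|v|^2]. The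
    latter pays [eta / 4] for the quadratic term, as [13 / 64 <= 1 / 4], and [eta / 4] for the
    growth of the gaps. One half of [lam * E] pays for the error of the estimator, the other half
    for the gap that remains. *)
Lemma lyapunov_step x y z :
  let yK := inner_y f g t s K x y in
  let zK := inner_z g t K x z in
  lyapunov (x - eta *: hypergrad_est f g s x yK zK) yK zK <=
    lyapunov x y z - eta / 2 * enorm (grad (hyperobj f g) x) ^+ 2 + eta / 4 * eps ^+ 2.
Proof.
rewrite /=; set yK := inner_y _ _ _ _ _ _ _; set zK := inner_z _ _ _ _ _.
set v := hypergrad_est _ _ _ _ _ _; set x' := x - eta *: v.
set G := grad _ x; set E := tracking_gap x y z.
have E0 : 0 <= E by rewrite addr_ge0 ?upper_gap_ge0 ?lower_gap_ge0.
have EK : tracking_gap x yK zK <= a * E.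
  by rewrite mulrDr lerD ?upper_gap_inner ?lower_gap_inner.
have EK0 : 0 <= tracking_gap x yK zK by rewrite addr_ge0 ?upper_gap_ge0 ?lower_gap_ge0.
have [_ Q _] := hyperobj_smooth SA Cf_le Lf_le Lg_le rhog_le lE k_ge1 x.
have {Q} := Q x'; have xE : x' - x = - (eta *: v) by rewrite /x' addrAC subrr add0r.
rewrite xE enormN enormZ (gtr0_norm eta_gt0) dotNr dotZr -/G.
rewrite ler_norml => /andP[_ Q].
have err := hypergrad_est_error x yK zK; rewrite -/v -/G in err.
have mv := tracking_gap_move x x' yK zK.
have xE' : enorm (x - x') ^+ 2 = eta ^+ 2 * enorm v ^+ 2.
  by rewrite enormC xE enormN enormZ exprMn (gtr0_norm eta_gt0).
rewrite xE' in mv.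
have pol : dot G v = (enorm G ^+ 2 + enorm v ^+ 2 - enorm (v - G) ^+ 2) / 2.
  by rewrite !enorm_sqr !(dotBl, dotBr) (dotC v G); field.
set nv := enorm v ^+ 2 in Q mv xE' pol *.
set nG := enorm G ^+ 2 in pol *; set ne := enorm (v - G) ^+ 2 in pol err *.
have nv0 : 0 <= nv by exact: sqr_ge0.
have lk3 : l * k ^+ 3 * eta = 64^-1.
  by rewrite etaE; field; rewrite !gt_eqF ?exprn_gt0.
have Q1 : 13 * (l * k ^+ 3) * (eta * enorm v) ^+ 2 <= eta / 4 * nv.
  rewrite exprMn -/nv.
  have -> : 13 * (l * k ^+ 3) * (eta ^+ 2 * nv) = 13 * (l * k ^+ 3 * eta) * (eta * nv) by ring.
  have : 0 <= eta * nv by rewrite mulr_ge0// ltW.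
  by rewrite lk3; lra.
have err1 : eta / 2 * ne <= eta / 4 * eps ^+ 2 + lam / 2 * E.
  have S1 : 1296 * (l * k ^+ 3 * s) ^+ 2 <= eps ^+ 2.
    have -> : 1296 * (l * k ^+ 3 * s) ^+ 2 = (36 * (l * k ^+ 3 * s)) ^+ 2 by ring.
    by rewrite ler_pXn2r ?nnegrE ?(ltW eps_gt0)// !mulr_ge0 ?exprn_ge0// ltW.
  have E1 : 128 * (l * k) / s ^+ 2 * tracking_gap x yK zK
      <= 128 * (l * k) / s ^+ 2 * (a * E).
    by rewrite ler_wpM2l// divr_ge0 ?sqr_ge0// !mulr_ge0// ltW.
  have : ne <= eps ^+ 2 / 2 + 128 * (l * k) / s ^+ 2 * (a * E) by lra.
  move=> /(ler_wpM2l (divr_ge0 (ltW eta_gt0) (ler0n R 2))) /le_trans; apply.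
  rewrite le_eqVlt; apply/orP; left; apply/eqP; rewrite /lam; field.
  by rewrite gt_eqF.
have mv1 : lam * tracking_gap x' yK zK <= lam / 2 * E + eta / 4 * nv.
  have M1 : 16 * k * tracking_gap x yK zK <= E / 2.
    have : 16 * k * tracking_gap x yK zK <= 16 * k * (a * E).
      by rewrite ler_wpM2l// mulr_ge0// ltW.
    by have := ler_wpM2r E0 a_k; lra.
  have M2 : lam * (36 * (l * k ^+ 2) * (eta ^+ 2 * nv)) <= eta / 4 * nv.
    have -> : lam * (36 * (l * k ^+ 2) * (eta ^+ 2 * nv))
        = 4608 * (l * k ^+ 3 * eta) ^+ 2 * (a / s ^+ 2 * (k ^+ 3)^-1) * (eta * nv).
      by rewrite /lam; field; rewrite !gt_eqF.
    have A1 : a / s ^+ 2 * (k ^+ 3)^-1 <= 8^-1.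
      rewrite ler_pdivrMr ?exprn_gt0// ler_pdivrMr ?exprn_gt0//.
      have : 1 <= k ^+ 3 by rewrite exprn_ege1.
      have s2 := sqr_ge0 s => k3.
      have := ler_wpM2r s2 k3; have := a_s; lra.
    rewrite lk3; have env : 0 <= eta * nv by rewrite mulr_ge0// ltW.
    have := ler_wpM2r env A1; lra.
  by have := ler_wpM2l lam_ge0 mv; rewrite mulrDr;
     have := ler_wpM2l lam_ge0 M1; lra.
rewrite /lyapunov -/E pol in Q *; lra.
Qed.

Let X x0 y0 j := F2BA_x f g eta t s K x0 y0 j.

Lemma lyapunov_descent x0 y0 N :
  (forall j, (j < N)%N -> eps < enorm (grad (hyperobj f g) (X x0 y0 j))) ->
  hyperobj f g (X x0 y0 N)
    <= lyapunov x0 y0 y0 - N%:R * (eta / 4 * eps ^+ 2).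
Proof.
move=> big; suff : let: (x, y, z) := F2BA f g eta t s K x0 y0 N in
    lyapunov x y z <= lyapunov x0 y0 y0 - N%:R * (eta / 4 * eps ^+ 2).
  rewrite /X /F2BA_x; case: (F2BA _ _ _ _ _ _ _ _ _) => [[x y] z] /=.
  move=> H; apply: le_trans H; rewrite /lyapunov lerDl mulr_ge0 ?lam_ge0//.
  by rewrite addr_ge0 ?upper_gap_ge0 ?lower_gap_ge0.
elim: N big => [|N IH] big; first by rewrite /= mul0r subr0.
have {}IH := IH (fun j jN => big j (ltnW jN)).
have := big N (leqnn _); rewrite /X /F2BA_x /=; move: IH.
case: (F2BA _ _ _ _ _ _ _ _ N) => [[x y] z] /= IH epsG.
rewrite (le_trans (lyapunov_step x y z))// -[in leRHS](addn1 N) natrD mulrDl mul1r.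
have : eps ^+ 2 <= enorm (grad (hyperobj f g) x) ^+ 2.
  by rewrite ler_pXn2r ?nnegrE ?enorm_ge0 ?(ltW eps_gt0)// ltW.
move=> /(ler_wpM2l (divr_ge0 (ltW eta_gt0) (ler0n R 2))); lra.
Qed.

End Tracking.

(** * Elementary bounds on powers, ceilings and distances *)

Section Constants.
Context {R : realType}.

Lemma contraction_pow_le (u y : R) (K n : nat) : 0 <= u <= 1 -> 0 < y ->
  n%:R * ln y <= u * K%:R -> (1 - u) ^+ K <= y ^- n.
Proof.
move=> /andP[u0 u1] y0 uK.
apply: (@le_trans _ _ (expR (- u) ^+ K)).
  by apply: lerXn2r; rewrite ?nnegrE ?subr_ge0 ?expR_ge0//; exact: expR_ge1Dx.
rewrite -expRM_natl -[y in leRHS]lnK ?posrE// -expRM_natl -expRN ler_expR.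
by rewrite mulrN lerN2 [leRHS]mulrC.
Qed.

Lemma absz_ceil_ge (x : R) : x <= (`|Num.ceil x|%N)%:R.
Proof.
rewrite natr_absz (le_trans (Num.Theory.ceil_ge x))// ler_int; exact: ler_norm.
Qed.

Lemma absz_ceil_le (x : R) : 0 <= x -> (`|Num.ceil x|%N)%:R <= x + 1.
Proof.
move=> x0; rewrite natr_absz ger0_norm; last first.
  by rewrite -(ler_int R) (le_trans x0)// Num.Theory.ceil_ge.
by have := ltW (Num.Theory.ceilB1_lt x); rewrite intrB lerBlDr.
Qed.

(** The infimum need not be attained; at positive distance the factor 2 leaves room for an almost
    nearest point. *)
Lemma dist_near n (v : 'rV[R]_n) (S : set 'rV[R]_n) : S !=set0 -> 0 < dist v S ->
  exists2 s, S s & enorm (v - s) <= 2 * dist v S.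
Proof.
move=> [s0 Ss0] d0.
have hi : has_inf [set enorm (v - s) | s in S].
  by split; [exists (enorm (v - s0)), s0|exists 0 => _ [s _ <-]; exact: enorm_ge0].
have [_ [s Ss <-] h] := inf_adherent d0 hi.
by exists s => //; rewrite mulr2n mulrDl mul1r ltW.
Qed.

Lemma dist_mem n (v : 'rV[R]_n) (S : set 'rV[R]_n) : S v -> dist v S <= 0.
Proof.
move=> Sv; have -> : 0 = enorm (v - v) by rewrite subrr enorm0.
apply: ge_inf; last by exists v.
by exists 0 => _ [s _ <-]; exact: enorm_ge0.
Qed.

End Constants.

(** * The iteration bound *)

Section Convergence.
Context {R : realType} {dx dy : nat}.
Variables (f g : 'rV[R]_dx -> 'rV[R]_dy -> R) (mu Cf Lf Lg rhof rhog sbar : R).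
Hypothesis SA : standing_assumption f g mu Cf Lf Lg rhof rhog sbar.

(** If none of the [T.+1] iterates up to index [T] were stationary, the descent would push [phi]
    below its infimum. Half of the decrease of one step absorbs the initial [lam * E], which leaves
    [eta / 8 * eps ^+ 2] per step, the inverse of [512 * (l * k ^+ 3 * eps ^- 2)]. *)
Lemma F2BA_finds_stationary (l k s eps eta C m : R) (K T : nat) x0 y0 :
  Cf <= l -> Lf <= l -> Lg <= l -> rhog <= l -> l = k * mu -> 1 <= k -> mu <= Lg ->
  admissible Lf Lg sbar s -> 0 < eps -> eta = 64^-1 * (l^-1 * k ^- 3) ->
  36 * (l * k ^+ 3 * s) <= eps -> 32 * (k * s) <= 1 -> s * C <= 1 ->
  (1 - (s * Lf + Lg)^-1 * mu) ^+ K <= s ^+ 5 ->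
  tracking_gap f g s x0 y0 y0 <= l * C ->
  let phi := hyperobj f g in
  has_lbound (range phi) -> phi x0 - inf (range phi) <= m ->
  (512 * m + 1) * (l * k ^+ 3 * eps ^- 2) < T.+1%:R ->
  exists t, (t <= T)%N /\
    stationary eps phi (F2BA_x f g eta (s * Lf + Lg)^-1 s K x0 y0 t).
Proof.
move=> Cl Ll Lgl rl lE k1 muLg As eps0 etaE s_eps s_k sC a_s5 E0 phi lb Dm TN.
have k0 : 0 < k by exact: lt_le_trans k1.
have l0 : 0 < l by exact: lt_le_trans (sa_Lg_gt0 SA) Lgl.
have s0 : 0 < s by case: As.
set a := (1 - _) ^+ K in a_s5.
have a0 : 0 <= a by rewrite exprn_ge0// subr_ge0 (step_mu_le1 SA muLg As).
have s32 : 32 * s <= 1.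
  by rewrite (le_trans _ s_k)// ler_wpM2l// ler_peMl// ltW.
have s1 : s <= 1 by lra.
have sX (i : nat) : 0 <= s ^+ i <= 1 by rewrite exprn_ge0 ?exprn_ile1 ?(ltW s0).
have a_k : 32 * k * a <= 1.
  apply: le_trans s_k; rewrite -mulrA ler_wpM2l// ler_wpM2l ?(ltW k0)//.
  by rewrite (le_trans a_s5)// exprS ler_piMr ?(ltW s0)//; case/andP: (sX 4%N).
have a_s : 8 * a <= s ^+ 2.
  have : s ^+ 5 <= s ^+ 2 * s.
    by rewrite -exprSr (exprD s 3 2) ler_piMr; case/andP: (sX 3%N); case/andP: (sX 2%N).
  have : s ^+ 2 * (32 * s) <= s ^+ 2 * 1.
    by rewrite ler_wpM2l//; case/andP: (sX 2%N).
  by case/andP: (sX 2%N); lra.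
have eta0 : 0 < eta by rewrite etaE !mulr_gt0 ?invr_gt0 ?exprn_gt0.
apply: contrapT => none.
have big j : (j < T.+1)%N ->
    eps < enorm (grad phi (F2BA_x f g eta (s * Lf + Lg)^-1 s K x0 y0 j)).
  move=> jT; rewrite ltNge; apply/negP => small; apply: none; exists j; split=> //.
  by split=> //; have [] := hyperobj_smooth SA Cl Ll Lgl rl lE k1
    (F2BA_x f g eta (s * Lf + Lg)^-1 s K x0 y0 j).
have := lyapunov_descent SA Cl Ll Lgl rl lE k1 muLg As eps0 etaE s_eps a_k a_s big.
rewrite /lyapunov -/a -/phi.
set XN := F2BA_x _ _ _ _ _ _ _ _ _; set E := tracking_gap _ _ _ _ _ _ in E0 *.
have infN : inf (range phi) <= phi XN by apply: ge_inf => //; exists XN.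
move: (phi XN) infN => pN infN; move: (phi x0) (inf _) Dm infN => p0 pi Dm infN.
have E_ge0 : 0 <= E.
  by apply: addr_ge0; [exact: (upper_gap_ge0 SA As)|exact: (lower_gap_ge0 SA)].
move: E E0 E_ge0 => E E0 E_ge0 desc.
(* Origin of the fifth power: two factors [s] cancel the [s ^+ 2] in the weight, two are turned into
   [eps ^+ 2] by the bound on [s], and one absorbs [C]. *)
have lamE : 128 * eta * (l * k) * a / s ^+ 2 * E <= eta / 8 * eps ^+ 2.
  have -> : 128 * eta * (l * k) * a / s ^+ 2 * E
      = eta / 8 * (1024 * (l * k) * (a * E) / s ^+ 2) by field; rewrite gt_eqF.
  rewrite ler_wpM2l ?divr_ge0 ?(ltW eta0)// ler_pdivrMr ?exprn_gt0//.
  have aE : a * E <= l * s ^+ 4.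
    rewrite (@le_trans _ _ (s ^+ 5 * (l * C)))//; first exact: ler_pM.
    have -> : s ^+ 5 * (l * C) = l * s ^+ 4 * (s * C) by ring.
    by rewrite ler_piMr// mulr_ge0 ?(ltW l0)//; case/andP: (sX 4%N).
  have lk : 0 <= l * k by rewrite mulr_ge0// ltW.
  apply: (@le_trans _ _ (1024 * (l * k) * (l * s ^+ 4))).
    by apply: ler_wpM2l aE; rewrite mulr_ge0 ?ler0n.
  apply: (@le_trans _ _ ((36 * (l * k ^+ 3 * s)) ^+ 2 * s ^+ 2)); last first.
    rewrite ler_wpM2r ?sqr_ge0// ler_pXn2r ?nnegrE ?(ltW eps0)//.
    by rewrite !mulr_ge0 ?exprn_ge0// ltW.
  have -> : (36 * (l * k ^+ 3 * s)) ^+ 2 * s ^+ 2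
    = 1296 * (l ^+ 2 * s ^+ 4 * k) * k ^+ 5 by ring.
  have -> : 1024 * (l * k) * (l * s ^+ 4) = 1024 * (l ^+ 2 * s ^+ 4 * k) * 1 by ring.
  have B0 : 0 <= l ^+ 2 * s ^+ 4 * k.
    by rewrite !mulr_ge0 ?exprn_ge0// ltW.
  have k5 : 1 <= k ^+ 5 by rewrite exprn_ege1.
  move: (l ^+ 2 * s ^+ 4 * k) B0 (k ^+ 5) k5 => B B0 k5 k5_ge1.
  by have := ler_wpM2l B0 k5_ge1; lra.
pose X := l * k ^+ 3 * eps ^- 2.
have X0 : 0 < X by rewrite !mulr_gt0 ?invr_gt0 ?exprn_gt0.
have etaX : eta * eps ^+ 2 = (64 * X)^-1.
  by rewrite etaE /X; field; rewrite !gt_eqF.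
have N1 : 1 <= T.+1%:R :> R by rewrite ler1n.
rewrite -/X in TN; move: (T.+1%:R : R) N1 TN desc => N N1 TN desc.
have D0 : 0 < eta / 8 * eps ^+ 2 by rewrite mulr_gt0 ?divr_gt0 ?exprn_gt0.
have Nd : N * (eta / 8 * eps ^+ 2) <= m.
  have := ler_wpM2r (ltW D0) N1; move: lamE desc Dm infN; lra.
have : m < N * (eta / 8 * eps ^+ 2).
  have -> : eta / 8 * eps ^+ 2 = (512 * X)^-1.
    by rewrite mulrAC etaX; field; rewrite gt_eqF.
  have X512 : 0 < 512 * X by rewrite mulr_gt0 ?ltr0n.
  rewrite (ltr_pdivlMr _ _ X512); move: X X0 TN {X512 etaX} => X X0 TN; lra.
by rewrite ltNge Nd.
Qed.

End Convergence.

(** * Choice of the numerical constants *)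

Section Tuning.
Context {R : realType}.

(** Here [q] stands for [k * s] and [r] for [R0]. Each summand of the inverse of [c] buys one
    inequality: 36 the bias bound, [32 * m] the contraction of moved gaps, and the last two the
    absorption of the initial gap. *)
Lemma sigma_small (m r q s c : R) : 0 <= m -> 0 < r <= m ->
  c = (36 + 32 * m + 10 * m ^+ 2 + 8 * m ^+ 3)^-1 -> 0 <= s -> s <= q -> q <= c * r ->
  [/\ c <= 36^-1, 32 * q <= 1 & s * (10 * r + 8 * q ^+ 2) <= 1].
Proof.
move=> m0 /andP[r0 rm] cE s0 sq qc.
have m2 := sqr_ge0 m; have m3 : 0 <= m ^+ 3 by rewrite exprn_ge0.
set W := 36 + _ + _ + _ in cE.
have W36 : 36 <= W by rewrite /W; lra.
have W0 : 0 < W by lra.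
have c0 : 0 < c by rewrite cE invr_gt0.
have cW : c * W = 1 by rewrite cE mulVf// gt_eqF.
have c36 : c <= 36^-1 by rewrite cE lef_pV2 ?posrE//; lra.
have q0 : 0 <= q := le_trans s0 sq.
have cm : c * r <= c * m by rewrite ler_wpM2l// ltW.
have cm1 : 0 <= c * m by rewrite mulr_ge0// ltW.
have cm2 : 0 <= c * m ^+ 2 by rewrite mulr_ge0// ltW.
have cm3 : 0 <= c * m ^+ 3 by rewrite mulr_ge0// ltW.
have cWE : 36 * c + 32 * (c * m) + 10 * (c * m ^+ 2) + 8 * (c * m ^+ 3) = 1.
  by rewrite -[RHS]cW /W; ring.
split=> //; first by lra.
have qr : q <= m.
  apply: le_trans qc (le_trans cm _); rewrite ler_piMl//; lra.
have q2 : q ^+ 2 <= m ^+ 2 by rewrite ler_pXn2r ?nnegrE.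
apply: (@le_trans _ _ (c * m * (10 * m + 8 * m ^+ 2))).
  apply: ler_pM => //; last by lra.
    by have := sqr_ge0 q; lra.
  exact: le_trans sq (le_trans qc cm).
have -> : c * m * (10 * m + 8 * m ^+ 2) = 10 * (c * m ^+ 2) + 8 * (c * m ^+ 3) by ring.
by lra.
Qed.

(** The factor 10 is the exponent 5 times the loss 2 in [mu / (2 * Lg) <= u]. As [mu <= Lg], the
    argument of the logarithm is at least [s^-1]. *)
Lemma contraction_sigma (mu Lg u s : R) (K : nat) :
  0 < mu -> mu <= Lg -> mu / (2 * Lg) <= u <= 1 -> 0 < s <= 1 ->
  10 * (Lg / mu * ln (Lg / (mu * s))) <= K%:R -> (1 - u) ^+ K <= s ^+ 5.
Proof.
move=> mu0 muLg /andP[ul u1] /andP[s0 s1] hK.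
have Lg0 : 0 < Lg := lt_le_trans mu0 muLg.
set y := Lg / (mu * s) in hK.
have y0 : 0 < y by rewrite divr_gt0// mulr_gt0.
have ys : y^-1 <= s.
  by rewrite invf_div ler_pdivrMr// mulrC ler_wpM2l// ltW.
have y1 : 1 <= y by rewrite -invf_le1//; exact: le_trans s1.
have u0 : 0 <= u by apply: le_trans ul; rewrite divr_ge0 ?mulr_ge0// ltW.
apply: (@le_trans _ _ (y ^- 5)).
  apply: contraction_pow_le => //; first by rewrite u0.
  rewrite (@le_trans _ _ (mu / (2 * Lg) * (10 * (Lg / mu * ln y))))//.
    by rewrite le_eqVlt; apply/orP; left; apply/eqP; field; rewrite !gt_eqF.
  apply: ler_pM => //; first by rewrite divr_ge0 ?mulr_ge0// ltW.
  by rewrite !mulr_ge0 ?invr_ge0 ?ln_ge0// ltW.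
by rewrite -exprVn; apply: lerXn2r; rewrite ?nnegrE ?invr_ge0 ?(ltW y0) ?(ltW s0).
Qed.

(** The argument of the logarithm in [K] is at most [l * k ^+ 4 / (c * eps)], hence at most [X ^+ 5]
    for small [eps]. The threshold on [eps] may not depend on [mu], so the power of [X] has to
    supply the [k ^+ 4]. Finally [ln X >= 1] absorbs additive constants: [156 = 3 * 50 + 6]. *)
Lemma oracle_calls_le (mu l k Lg rho eps c s cT : R) (T K : nat) :
  0 < mu -> l = k * mu -> 1 <= k -> 0 < Lg <= l -> 0 < rho -> 0 < c -> 0 < cT ->
  0 < eps <= 1 -> eps <= c * rho ^+ 5 * l ^+ 4 -> eps <= rho * l / expR 1 ->
  c * (eps / (l * k ^+ 3)) <= s -> 1 <= Lg / (mu * s) ->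
  K%:R <= 10 * (Lg / mu * ln (Lg / (mu * s))) + 1 ->
  T%:R <= cT * (l * k ^+ 3 * eps ^- 2) ->
  (F2BA_oracle_calls T K)%:R
    <= 156 * cT * (l * k ^+ 4 * eps ^- 2 * ln (rho * l * k / eps)).
Proof.
move=> mu0 lE k1 /andP[Lg0 Lgl] rho0 c0 cT0 /andP[eps0 eps1] epsc epse cs y1 hK hT.
have k0 : 0 < k := lt_le_trans ltr01 k1.
have l0 : 0 < l := lt_le_trans Lg0 Lgl.
have s0 : 0 < s.
  by apply: lt_le_trans cs; rewrite mulr_gt0// divr_gt0// mulr_gt0// exprn_gt0.
set y := Lg / (mu * s) in y1 hK.
have y0 : 0 < y := lt_le_trans ltr01 y1.
set X := rho * l * k / eps.
have X0 : 0 < X by rewrite !mulr_gt0 ?invr_gt0.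
have lX1 : 1 <= ln X.
  rewrite -[1]expRK ler_ln ?posrE ?expR_gt0// /X ler_pdivlMr//.
  rewrite mulrC (@le_trans _ _ (rho * l))//.
    by rewrite -ler_pdivlMr ?expR_gt0.
  by rewrite ler_peMr// mulr_ge0// ltW.
have yX : y <= X ^+ 5.
  apply: (@le_trans _ _ (l * k ^+ 4 / (c * eps))).
    rewrite /y ler_pdivrMr ?mulr_gt0//.
    apply: (le_trans Lgl).
    have -> : l * k ^+ 4 / (c * eps) * (mu * s)
        = k ^+ 4 * mu * l * (s / (c * eps)) by ring.
    rewrite (@le_trans _ _ (k ^+ 4 * mu * l * (l * k ^+ 3)^-1))//.
      by rewrite lE le_eqVlt; apply/orP; left; apply/eqP; field; rewrite !gt_eqF.
    rewrite ler_wpM2l//; first by rewrite !mulr_ge0 ?exprn_ge0// ltW.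
    rewrite ler_pdivlMr ?mulr_gt0//; apply: le_trans cs.
    by rewrite le_eqVlt; apply/orP; left; apply/eqP; ring.
  rewrite ler_pdivrMr ?mulr_gt0//.
  have -> : X ^+ 5 * (c * eps) = l * k ^+ 4 * (k * (c * rho ^+ 5 * l ^+ 4 / eps ^+ 4)).
    by rewrite /X; field; rewrite gt_eqF.
  rewrite ler_peMr//; first by rewrite mulr_ge0 ?exprn_ge0// ltW.
  apply: mulr_ege1 => //; rewrite ler_pdivlMr ?exprn_gt0// mul1r.
  by apply: le_trans epsc; rewrite exprS ler_piMr ?(ltW eps0)// exprn_ile1// ltW.
have lyX : ln y <= 5 * ln X.
  have -> : 5 * ln X = ln (X ^+ 5) by rewrite lnXn// mulr_natl.
  by rewrite ler_ln ?posrE ?exprn_gt0.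
have Lmu : Lg / mu <= k by rewrite ler_pdivrMr// -lE.
have lny0 : 0 <= ln y by rewrite ln_ge0.
have K1 : K%:R * 3 + 3 <= k * (156 * ln X).
  have : Lg / mu * ln y <= k * (5 * ln X).
    by apply: ler_pM => //; rewrite divr_ge0// ltW.
  have : 1 <= k * ln X by apply: mulr_ege1.
  lra.
rewrite /F2BA_oracle_calls natrM natrD natrM.
apply: le_trans (ler_pM _ _ hT K1) _ => //.
by rewrite le_eqVlt; apply/orP; left; apply/eqP; ring.
Qed.

End Tuning.

(** [M] makes boundedness of [Delta] and [R] quantitative, so that the hidden constants may depend
    on it and on nothing else. The threshold [eps0] precedes [mu], which makes the small [eps]
    regime uniform in the condition number. [0 < R0] keeps [sigma], by which the estimator divides,
    positive. *)
Theorem theorem4p1 (R : realType) (M : R) :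
  exists c_eta c_sigma c_K c_T c_O : R,
    [/\ 0 < c_eta, 0 < c_sigma, 0 < c_K, 0 < c_T & 0 < c_O] /\
    forall Cf Lf Lg rhof rhog sbar R0 : R,
    exists eps0 : R, 0 < eps0 /\
    forall (dx dy : nat) (f g : 'rV[R]_dx -> 'rV[R]_dy -> R) (mu : R)
      (x0 : 'rV[R]_dx) (y0 : 'rV[R]_dy) (eps : R),
    let ell := Num.max Cf (Num.max Lf (Num.max Lg rhog)) in
    let kappa := ell / mu in
    let phi := hyperobj f g in
    let Delta := phi x0 - inf (range phi) in
    let eta := c_eta * (ell^-1 * kappa ^- 3) in
    let sigma := c_sigma *
      Num.min (R0 / kappa) (Num.min (eps / (ell * kappa ^+ 3))
        (Num.min (Lg / Lf) (Num.min (rhog / rhof) sbar))) in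
    let tau := (sigma * Lf + Lg)^-1 in
    let K := `|Num.ceil (c_K * (Lg / mu * ln (Lg / (mu * sigma))))|%N in
    standing_assumption f g mu Cf Lf Lg rhof rhog sbar ->
    1 <= kappa ->
    R0 = dist y0 (Ystar g x0) ^+ 2 -> 0 < R0 -> R0 <= M ->
    has_lbound (range phi) -> Delta <= M ->
    0 < eps -> eps <= M ->
    exists T : nat,
      [/\ T%:R <= c_T * (ell * kappa ^+ 3 * eps ^- 2),
          (exists t : nat, (t <= T)%N /\
             stationary eps phi (F2BA_x f g eta tau sigma K x0 y0 t))
        & eps <= eps0 ->
          (F2BA_oracle_calls T K)%:R <=
            c_O * (ell * kappa ^+ 4 * eps ^- 2 * ln (rhof * ell * kappa / eps))].
Proof.
pose m := `|M|; have m0 : 0 <= m by exact: normr_ge0.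
have [c c0 cE] : exists2 c, 0 < c & c = (36 + 32 * m + 10 * m ^+ 2 + 8 * m ^+ 3)^-1.
  eexists; last reflexivity.
  rewrite invr_gt0; have := sqr_ge0 m; have : 0 <= m ^+ 3 by rewrite exprn_ge0.
  by lra.
have [cT cT0 cTE] : exists2 cT, 0 < cT & cT = 512 * m + 1.
  by eexists; last reflexivity; lra.
exists 64^-1, c, 10, cT, (156 * cT); split.
  by split=> //; rewrite ?invr_gt0 ?ltr0n// mulr_gt0 ?ltr0n.
move=> Cf Lf Lg rhof rhog sbar R0.
pose l := Num.max Cf (Num.max Lf (Num.max Lg rhog)).
(* [eps0] is due before the standing assumption is available, so the signs of the constants are
   still unknown; if [pos] fails, the default 1 is returned. *)
pose pos := [/\ 0 < Lf, 0 < Lg, 0 < rhof & 0 < rhog] /\ 0 < sbar /\ 0 < R0.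
(* The first three entries serve the comparison of logarithms. The other four make
   [eps / (l * k ^+ 3)] the least entry of the minimum in [sigma], which bounds [sigma] from
   below. *)
pose e0 := Num.min 1 (Num.min (c * rhof ^+ 5 * l ^+ 4) (Num.min (rhof * l / expR 1)
  (Num.min (l * R0) (Num.min (l * (Lg / Lf)) (Num.min (l * (rhog / rhof)) (l * sbar)))))).
have Lgl : Lg <= l by rewrite !le_max lexx !orbT.
have e0_gt0 : pos -> 0 < e0.
  move=> [[Lf0 Lg0 rf0 rg0] [sb0 R00]].
  have l0 : 0 < l := lt_le_trans Lg0 Lgl.
  rewrite !lt_min ltr01 /=; do ?[apply/andP; split];
    by do ?[apply: divr_gt0|apply: exprn_gt0|apply: expR_gt0|apply: mulr_gt0].
exists (if pselect pos then e0 else 1); split.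
  by case: pselect => //; exact: e0_gt0.
move=> dx dy f g mu x0 y0 eps ell k phi Delta eta s tau K.
move=> SA k1 R0E R00 R0M lb DM eps_gt0 epsM.
have mu0 := sa_mu_gt0 SA; have Lg0 := sa_Lg_gt0 SA; have Lf0 := sa_Lf_gt0 SA.
have rf0 := sa_rhof_gt0 SA; have rg0 := sa_rhog_gt0 SA; have sb0 := sa_sbar_gt0 SA.
have Hpos : pos by do !split.
case: pselect => [posT|npos]; last by case: (npos Hpos).
have Cl : Cf <= ell by rewrite le_max lexx.
have Ll : Lf <= ell by rewrite !le_max lexx !orbT.
have rl : rhog <= ell by rewrite !le_max lexx !orbT.
have l0 : 0 < ell := lt_le_trans Lg0 Lgl.
have k0 : 0 < k := lt_le_trans ltr01 k1.
have lE : ell = k * mu by rewrite /k divfK// gt_eqF.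
have M0 : 0 < M := lt_le_trans eps_gt0 epsM.
have mE : m = M by rewrite /m gtr0_norm.
pose mn := Num.min (R0 / k) (Num.min (eps / (ell * k ^+ 3))
  (Num.min (Lg / Lf) (Num.min (rhog / rhof) sbar))).
have sE : s = c * mn by [].
have mn0 : 0 < mn.
  rewrite !lt_min; do ?[apply/andP; split];
    by do ?[apply: divr_gt0|apply: exprn_gt0|apply: mulr_gt0].
have s0 : 0 < s by rewrite sE mulr_gt0.
have [mn1 mn2 mn3 mn4] : [/\ mn <= R0 / k, mn <= eps / (ell * k ^+ 3),
    mn <= Lg / Lf & mn <= sbar].
  by split; rewrite !ge_min lexx ?orbT.
have sk : s <= k * s by rewrite ler_peMl// ltW.
have ksR : k * s <= c * R0.
  by rewrite sE mulrCA ler_wpM2l ?(ltW c0)// mulrC -ler_pdivlMr.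
have R0m : 0 < R0 <= m by rewrite R00 mE.
have [c36 s_k sC] := sigma_small m0 R0m cE (ltW s0) sk ksR.
have c1 : c <= 1 by lra.
have smn : s <= mn by rewrite sE ler_piMl// ltW.
have As : admissible Lf Lg sbar s.
  by split=> //; [exact: le_trans mn4|rewrite -ler_pdivlMr//; exact: le_trans mn3].
have s_eps : 36 * (ell * k ^+ 3 * s) <= eps.
  have : c * mn <= 36^-1 * (eps / (ell * k ^+ 3)).
    by apply: ler_pM => //; rewrite ltW.
  rewrite -sE => h; have lk3 : 0 <= ell * k ^+ 3 by rewrite mulr_ge0 ?exprn_ge0// ltW.
  apply: le_trans (ler_wpM2l (ler0n _ 36) (ler_wpM2l lk3 h)) _.
  by rewrite le_eqVlt; apply/orP; left; apply/eqP; field; rewrite !gt_eqF.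
have Yn0 : Ystar g x0 !=set0 by have [] := PL_lower SA x0.
have d0 : 0 < dist y0 (Ystar g x0).
  rewrite lt_neqAle eq_sym; apply/andP; split.
    by apply/eqP => d0; move: R00; rewrite R0E d0 expr0n ltxx.
  apply: lb_le_inf => [|_ [? _ <-]]; last exact: enorm_ge0.
  by have [y hy] := Yn0; exists (enorm (y0 - y)), y.
(* Since [R0 > 0], [y0] is not a minimizer of [g x0], and a positive gap excludes [Lg < mu]. *)
have muLg : mu <= Lg.
  apply: (PL_le_smooth Lg0 (lipschitz_grad_snd (sa_g_grad SA) x0) (PL_lower SA x0)) => hy.
  by have := lt_le_trans d0 (dist_mem hy); rewrite ltxx.
have [y hy ydist] := dist_near Yn0 d0.
have gap0 : tracking_gap f g s x0 y0 y0 <= ell * (10 * R0 + 8 * (k * s) ^+ 2).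
  have r0 : 0 <= 2 * dist y0 (Ystar g x0) by rewrite mulr_ge0// ltW.
  have := tracking_gap_init SA Cl Lgl lE As r0 (ex_intro2 _ _ y hy ydist).
  rewrite exprMn -R0E; have -> : 5 / 2 * (2 ^+ 2 * R0) = 10 * R0 by field.
  by [].
have s1 : s <= 1 by apply: le_trans sk _; move: s_k; lra.
have Kge : 10 * (Lg / mu * ln (Lg / (mu * s))) <= K%:R by exact: absz_ceil_ge.
have tmu : mu / (2 * Lg) <= tau * mu <= 1.
  rewrite (step_mu_le1 SA muLg As) andbT mulrC ler_wpM2r ?(ltW mu0)//.
  rewrite lef_pV2 ?posrE ?mulr_gt0 ?(penalty_const_gt0 SA As)//.
  by have [_ _] := As; lra.
have s01 : 0 < s <= 1 by rewrite s0.
have aK := contraction_sigma mu0 muLg tmu s01 Kge.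
pose Z := cT * (ell * k ^+ 3 * eps ^- 2).
have Z0 : 0 <= Z by rewrite !mulr_ge0 ?invr_ge0 ?exprn_ge0// ltW.
(* [T <= Z < T + 1]: rounding down respects the bound on [T], while the iterates with indices 0 to
   [T] number more than [Z], as the descent argument requires. *)
exists (Num.truncn Z); split.
- by have /andP[] := Num.Theory.truncn_itv Z0.
- apply: (F2BA_finds_stationary SA Cl Ll Lgl rl lE k1 muLg As eps_gt0 erefl s_eps s_k
    sC aK gap0 lb (m := m)); first by rewrite mE.
  by rewrite -cTE; exact: Num.Theory.truncnS_gt.
rewrite /e0 !le_min => /and5P[e1 e2 e3 e4 /and3P[e5 e6 e7]].
have lk3 : ell <= ell * k ^+ 3 by rewrite ler_peMr ?exprn_ege1// ltW.
have lk30 : 0 < ell * k ^+ 3 by rewrite mulr_gt0 ?exprn_gt0.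
have mnE : eps / (ell * k ^+ 3) <= mn.
  have bound b : 0 <= b -> eps <= ell * b -> eps / (ell * k ^+ 3) <= b.
    move=> b0 eb; rewrite (ler_pdivrMr _ _ lk30) (le_trans eb)// mulrC.
    by rewrite ler_wpM2l.
  rewrite /mn !le_min; apply/and5P; split.
  - rewrite (ler_pdivrMr _ _ lk30).
    have -> : R0 / k * (ell * k ^+ 3) = ell * R0 * k ^+ 2 by field; rewrite gt_eqF.
    rewrite (le_trans e4)// ler_peMr ?exprn_ege1//.
    by rewrite mulr_ge0// ltW.
  - exact: lexx.
  - by apply: bound; rewrite // divr_ge0// ltW.
  - by apply: bound; rewrite // divr_ge0// ltW.
  - by apply: bound; rewrite // ltW.
have csE : c * (eps / (ell * k ^+ 3)) <= s by rewrite sE ler_wpM2l// ltW.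
have y1 : 1 <= Lg / (mu * s).
  rewrite ler_pdivlMr ?mulr_gt0// mul1r (le_trans _ muLg)//.
  by rewrite ler_piMr// ltW.
have Kle : K%:R <= 10 * (Lg / mu * ln (Lg / (mu * s))) + 1.
  apply: absz_ceil_le; rewrite mulr_ge0 ?ler0n// mulr_ge0 ?ln_ge0//.
  by rewrite divr_ge0// ltW.
have Tle : (Num.truncn Z)%:R <= Z by have /andP[] := Num.Theory.truncn_itv Z0.
have Lgl' : 0 < Lg <= ell by rewrite Lg0.
have eps1 : 0 < eps <= 1 by rewrite eps_gt0.
exact: (oracle_calls_le mu0 lE k1 Lgl' rf0 c0 cT0 eps1 e2 e3 csE y1 Kle Tle).
Qed.
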